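(* For every integer $n\ge4$, $n\le TC(C\Omega_n)\le 2n-4$.
   Context: $C\Omega_n$ is (a cubical structure on) the anchored configuration space of the circle with two anchored points: the subspace of $(S^1)^n$ consisting of all tuples $(p_1,\dots,p_n)$ with $S\subseteq\{p_1,\dots,p_n\}$, where $S\subset S^1$ is a fixed set of two points. Concretely, its cells are the tuples $(x_1,y_1,x_2,y_2,x_3,y_3,x_4,y_4)$ of pairwise disjoint sets with union $\{1,\dots,n\}$ and $x_3\ne\emptyset\neq x_4$, of dimension $\sum_i|y_i|$, describing $n$ labelled points on the cycle graph $C_4$ ($x_i$: points at vertex $i$; $y_i$: points in the open edge from vertex $i$ to vertex $i+1$, indices mod 4), with vertices 3 and 4 being the anchored points. For a path-connected space $X$, $TC(X)$ is the (reduced) topological complexity: the smallest integer $k\ge0$ such that $X\times X$ has a cover by open sets $U_0,\dots,U_k$, each admitting a continuous section $s_i:U_i\to P(X)$ of the end-points evaluation map $P(X)\to X\times X$, where $P(X)$ is the space of continuous paths $[0,1]\to X$ ($TC(X)=\infty$ if no such $k$ exists). *)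

(* Defs.v *)
From HB Require Import structures.
From mathcomp Require Import all_boot all_order all_algebra.
From mathcomp Require Import all_classical all_reals all_analysis.

Set Implicit Arguments.
Unset Strict Implicit.
Unset Printing Implicit Defensive.

Import Order.TTheory GRing.Theory Num.Theory.
Import numFieldNormedType.Exports.

Local Open Scope classical_set_scope.
Local Open Scope ring_scope.

(* Sets are turned into subspaces by [set_type], whose topology is the initial
   one for the inclusion. *)
Notation unit_interval R := (set_type (`[0, 1]%classic : set R)).

Lemma mem_itv01_0 (R : realType) : (0 : R) \in (`[0, 1]%classic : set R).
Proof. by rewrite inE /= in_itv /= lexx ler01. Qed.

Lemma mem_itv01_1 (R : realType) : (1 : R) \in (`[0, 1]%classic : set R).
Proof. by rewrite inE /= in_itv /= lexx ler01. Qed.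

Definition time0 (R : realType) : unit_interval R := exist _ 0 (mem_itv01_0 R).

Definition time1 (R : realType) : unit_interval R := exist _ 1 (mem_itv01_1 R).

(* A separate alias, because [continuousType U V] itself already carries the
   uniform convergence topology when [V] is a uniform space. *)
Definition path_space (R : realType) (X : topologicalType) : Type :=
  continuousType (unit_interval R) X.

Definition path_fun (R : realType) (X : topologicalType)
    (g : path_space R X) : {compact-open, unit_interval R -> X} :=
  (g : continuousType (unit_interval R) X) : unit_interval R -> X.

HB.instance Definition _ (R : realType) (X : topologicalType) :=
  Choice.copy (path_space R X) (continuousType (unit_interval R) X).

HB.instance Definition _ (R : realType) (X : topologicalType) :=
  Topological.copy (path_space R X) (initial_topology (@path_fun R X)).

Definition path_ends (R : realType) (X : topologicalType)
    (g : path_space R X) : X * X :=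
  (path_fun g (time0 R), path_fun g (time1 R)).

Definition has_motion_planner (R : realType) (X : topologicalType)
    (k : nat) : Prop :=
  exists U : 'I_k.+1 -> set (X * X),
    [/\ forall i, open (U i),
        \bigcup_i U i = [set: X * X]
      & forall i, exists s : set_type (U i) -> path_space R X,
          continuous s /\ forall z, path_ends (s z) = set_val z].

Definition TC (R : realType) (X : topologicalType) : \bar R :=
  ereal_inf [set k%:R%:E | k in [set k | has_motion_planner R X k]].

Lemma TC_eq_nat (R : realType) (X : topologicalType) (k : nat) :
  TC R X = k%:R%:E <->
  has_motion_planner R X k /\ forall j, has_motion_planner R X j -> (k <= j)%N.
Proof.
split; last first.
  move=> [hk km]; apply/eqP; rewrite eq_le; apply/andP; split.
    by apply: ereal_inf_lbound; exists k.
  by apply: le_ereal_inf_tmp => _ [j /km kj <-]; rewrite lee_fin ler_nat.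
move=> h.
have km j : has_motion_planner R X j -> (k <= j)%N.
  move=> hj; rewrite -(@ler_nat R) -lee_fin -h.
  by apply: ereal_inf_lbound; exists j.
split=> //.
have : (TC R X < k.+1%:R%:E)%E by rewrite h lte_fin ltr_nat.
move=> /ereal_inf_lt[_ [j hj <-]]; rewrite lte_fin ltr_nat ltnS => jk.
by have -> : k = j by apply/eqP; rewrite eqn_leq jk km.
Qed.

Lemma TC_eq_pinfty (R : realType) (X : topologicalType) :
  TC R X = +oo%E <-> forall j, ~ has_motion_planner R X j.
Proof.
split=> [h j hj|h].
  have : (TC R X <= j%:R%:E)%E by apply: ereal_inf_lbound; exists j.
  by rewrite h.
rewrite /TC; apply/ereal_inf_pinfty => x [j hj].
by case: (h j hj).
Qed.

Definition circle (R : realType) : set (R * R) :=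
  [set z | z.1 ^+ 2 + z.2 ^+ 2 = 1].

Definition anchored_conf (R : realType) (n : nat)
    (S : set (set_type (@circle R))) :
    set {ptws 'I_n -> set_type (@circle R)} :=
  [set p | S `<=` range p].

(* Main.v *)
Require Import Defs.
From mathcomp Require Import all_boot all_order all_algebra.
From mathcomp Require Import all_classical all_reals all_analysis.
From mathcomp Require Import ring lra.
From Stdlib Require List.

(* Lower bound.  The four points 1, 2 of p and 3, 4 of q anchor the pairs (p, q)
   of an n-torus in X * X on which p_m / q_m runs, up to inversion, over the m-th
   circle factor.  Over an open set with a motion planner, following the planner
   lifts the function p_m / q_m to the reals, so the m-th coordinate class of the
   torus vanishes there.  If fewer than n + 1 such sets covered X * X, the product
   of the n coordinate classes, which is the top class of the torus, would vanish.
   The cup product is computed modulo 2 with cubical cochains on a fine grid.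

   Upper bound.  At least two of the n points of each configuration sit at the
   anchors, so at most 2n - 4 of the 2n coordinates of a pair are away from them.
   The pair lies in the k-th open set when some k of its coordinates are farther
   from the anchors than all the others.  There those k points are pushed to the
   antipode of b and the others to the nearest anchor; points at the anchors do
   not move, so this stays in X and reaches one of finitely many configurations,
   and X is path connected. *)

Set Implicit Arguments.
Unset Strict Implicit.
Unset Printing Implicit Defensive.

Import Order.TTheory GRing.Theory Num.Theory.
Import numFieldNormedType.Exports.

Local Open Scope ring_scope.

(** * Cup products of cubical cochains on a discrete torus *)

Section CubicalCochains.
Variables (n N : nat).

Local Notation V := {ffun 'I_n -> 'Z_N}.
Local Notation cochain := ('I_n -> V -> 'F_2).
Local Notation form := ({set 'I_n} -> V -> 'F_2).

Implicit Types (v : V) (A S : {set 'I_n}) (al : cochain) (phi : form).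

Definition vec A : V := [ffun i => (i \in A)%:R].

(* Cochains act on forms from the left, with the cubical rule that moving [dx_j]
   past a function translates it by the [j]-th unit vector; modulo 2 there are no
   signs.  [wedge theta] and [wedge1] multiply by the sum of all the [dx_j] on the
   left and on the right. *)
Definition wedge al phi : form :=
  fun S v => \sum_(j in S) al j v * phi (S :\ j) (v + vec [set j]).

Definition wedge1 phi : form := fun S v => \sum_(j in S) phi (S :\ j) v.

Definition scale (f : V -> 'F_2) phi : form := fun S v => f v * phi S v.

Definition addform phi psi : form := fun S v => phi S v + psi S v.

Definition one_form : form := fun S _ => (S == finset.set0)%:R.

Definition cup (s : seq cochain) phi : form := foldr wedge phi s.

Definition theta : cochain := fun _ _ => 1.

Definition coboundary (f : V -> 'F_2) : cochain :=
  fun j v => f (v + vec [set j]) + f v.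

Definition addcochain al be : cochain := fun j v => al j v + be j v.

(** The cocycle condition: modulo 2, [al] sums to zero around each coordinate square. *)
Definition closed_cochain al := forall i j v,
  al i v + al j (v + vec [set i]) = al j v + al i (v + vec [set j]).

(** Evaluation of the top-degree part on the fundamental class of the torus modulo 2. *)
Definition total phi := \sum_v phi [set: 'I_n] v.

Lemma addFF (x : 'F_2) : x + x = 0.
Proof. by apply: addrr_pchar2; rewrite pchar_Fp. Qed.

Lemma addF_eq0 (x y : 'F_2) : x + y = 0 -> x = y.
Proof. by move=> h; rewrite -[x]addr0 -(addFF y) addrA h add0r. Qed.

(** The terms at [(i, j)] and [(j, i)] cancel in characteristic 2. *)
Lemma sum_sym_offdiag (h : 'I_n -> 'I_n -> 'F_2) S :
  (forall i j, h i j = h j i) -> \sum_(i in S) \sum_(j in S :\ i) h i j = 0.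
Proof.
move=> hC; rewrite pair_big_dep /=.
rewrite (bigID (fun p : 'I_n * 'I_n => (p.1 < p.2)%N)) /=.
rewrite [X in _ + X](reindex_inj (inv_inj (f := fun p : 'I_n * 'I_n => (p.2, p.1)) _)) /=;
  last by case.
rewrite -[RHS](addFF (\sum_(p : 'I_n * 'I_n |
   (p.1 \in S) && (p.2 \in S :\ p.1) && (p.1 < p.2)%N) h p.1 p.2)).
congr (_ + _); apply: eq_big => [[i j]|[i j] _] /=; last exact: hC.
by rewrite !inE; case: (ltngtP i j) => [ij|ij|/val_inj ->];
  rewrite ?eqxx ?andbF ?andbT //= andbCA andbC (andbC (i \in S)) eq_sym //;
  case: (i \in S); case: (j \in S); rewrite ?andbF ?andbT //= -val_eqE /= ?eqn_leq ?ij // leqNgt ij.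
Qed.

Lemma wedgeDl al be phi :
  wedge (addcochain al be) phi = addform (wedge al phi) (wedge be phi).
Proof.
apply/funext => S; apply/funext => v.
by rewrite /wedge /addform -big_split; apply: eq_bigr => j _; rewrite mulrDl.
Qed.

Lemma wedgeDr al phi psi :
  wedge al (addform phi psi) = addform (wedge al phi) (wedge al psi).
Proof.
apply/funext => S; apply/funext => v.
by rewrite /wedge /addform -big_split; apply: eq_bigr => j _; rewrite mulrDr.
Qed.

Lemma cupD s phi psi :
  cup s (addform phi psi) = addform (cup s phi) (cup s psi).
Proof. by elim: s => //= al s ->; rewrite wedgeDr. Qed.

Lemma totalD phi psi : total (addform phi psi) = total phi + total psi.
Proof. exact: big_split. Qed.

Lemma wedge_coboundary f phi :
  wedge (coboundary f) phi =
  addform (wedge theta (scale f phi)) (scale f (wedge theta phi)).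
Proof.
apply/funext => S; apply/funext => v.
rewrite /wedge /addform /scale mulr_sumr -big_split /=; apply: eq_bigr => j _ /=.
by rewrite !mul1r -mulrDl.
Qed.

Lemma setD1C S (i j : 'I_n) : S :\ i :\ j = S :\ j :\ i.
Proof. by rewrite !finset.setDDl finset.setUC. Qed.

(** The sum of the two sides is an off-diagonal double sum, and closedness of [al] makes its terms
    symmetric in the two directions. *)
Lemma wedge_theta al phi : closed_cochain al ->
  wedge theta (wedge al phi) = wedge al (wedge theta phi).
Proof.
move=> cl; apply/funext => S; apply/funext => v; apply: addF_eq0.
rewrite /wedge -big_split /=.
pose h i j := (al i v + al j (v + vec [set i])) *
              phi (S :\ i :\ j) (v + vec [set i] + vec [set j]).
transitivity (\sum_(i in S) \sum_(j in S :\ i) h i j); last first.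
  apply: sum_sym_offdiag => i j.
  by rewrite /h setD1C addrAC; congr (_ * _); rewrite addrC -cl addrC.
apply: eq_bigr => i _; rewrite [theta _ _ * _]mul1r mulr_sumr -big_split /=.
by apply: eq_bigr => j _; rewrite mul1r -mulrDl addrC.
Qed.

Lemma exchange_offdiag S (h : 'I_n -> 'I_n -> 'F_2) :
  \sum_(i in S) \sum_(j in S :\ i) h i j = \sum_(j in S) \sum_(i in S :\ j) h i j.
Proof.
rewrite (exchange_big_dep (mem S)) /=; last by move=> i j _; rewrite inE => /andP[].
apply: eq_bigr => j jS; apply: eq_bigl => i.
by rewrite !inE jS andbT eq_sym andbC.
Qed.

Lemma wedge_wedge1 al phi : wedge al (wedge1 phi) = wedge1 (wedge al phi).
Proof.
apply/funext => S; apply/funext => v; rewrite /wedge /wedge1.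
under eq_bigr do rewrite mulr_sumr.
rewrite exchange_offdiag; apply: eq_bigr => i _; apply: eq_bigr => j _.
by rewrite setD1C.
Qed.

Lemma scale_wedge1 f phi : scale f (wedge1 phi) = wedge1 (scale f phi).
Proof.
by apply/funext => S; apply/funext => v; rewrite /scale /wedge1 mulr_sumr.
Qed.

Lemma cup_wedge1 s phi : cup s (wedge1 phi) = wedge1 (cup s phi).
Proof. by elim: s => //= al s ->; rewrite wedge_wedge1. Qed.

Lemma wedge_theta_one : wedge theta one_form = wedge1 one_form.
Proof.
by apply/funext => S; apply/funext => v; apply: eq_bigr => j _; rewrite mul1r.
Qed.

(** The two products differ by unit translations, which the sum over all vertices absorbs. *)
Lemma total_wedge_theta phi : total (wedge theta phi) = total (wedge1 phi).
Proof.
rewrite /total /wedge /wedge1 exchange_big [RHS]exchange_big /=.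
apply: eq_bigr => j _; rewrite [RHS](reindex_inj (addIr (vec [set j]))) /=.
by apply: eq_bigr => v _; rewrite mul1r.
Qed.

Definition all_closed (s : seq cochain) := forall al, List.In al s -> closed_cochain al.

Lemma cup_theta s phi : all_closed s ->
  cup s (wedge theta phi) = wedge theta (cup s phi).
Proof.
elim: s => //= al s ih cl; rewrite ih; last by move=> be h; apply: cl; right.
by rewrite wedge_theta //; apply: cl; left.
Qed.

(* Stokes: up to the closed factors, [df] is the commutator of [f] with
   [theta], and [total] is a trace. *)
Lemma total_cup_coboundary s1 f s2 : all_closed s1 -> all_closed s2 ->
  total (cup s1 (wedge (coboundary f) (cup s2 one_form))) = 0.
Proof.
move=> cl1 cl2; rewrite wedge_coboundary cupD totalD cup_theta //.
rewrite -(@cup_theta s2 one_form) // wedge_theta_one !(cup_wedge1, scale_wedge1).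
by rewrite total_wedge_theta addFF.
Qed.

(** The coboundaries are removed one factor at a time, each by Stokes. *)
Lemma total_cup_perturb s1 (l : seq (cochain * (V -> 'F_2))) :
  all_closed s1 -> (forall p, List.In p l -> closed_cochain p.1) ->
  total (cup s1 (cup [seq addcochain p.1 (coboundary p.2) | p <- l] one_form)) =
  total (cup s1 (cup [seq p.1 | p <- l] one_form)).
Proof.
have closed_cob f : closed_cochain (coboundary f).
  have cancel2 (c x y : 'F_2) : y + c + (x + y) = c + x.
    by rewrite (addrC y) addrACA addFF addr0.
  by move=> i j v; rewrite /coboundary (addrAC v (vec [set j])) !cancel2.
elim: l s1 => //= -[be f] l ih s1 cl1 cll /=.
have clm : all_closed [seq addcochain p.1 (coboundary p.2) | p <- l].
  move=> al /List.in_map_iff [p [<- pl]] i j v.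
  by rewrite /addcochain addrACA (cll p (or_intror pl)) closed_cob addrACA.
rewrite wedgeDl cupD totalD total_cup_coboundary // addr0.
(* The factor just cleaned joins the closed prefix, so that induction applies to the rest. *)
have cup_rcons phi : cup s1 (wedge be phi) = cup (s1 ++ [:: be]) phi.
  by rewrite /cup foldr_cat.
rewrite !cup_rcons.
apply: ih; last by move=> p pl; apply: cll; right.
move=> al /(@List.in_app_or _ s1 [:: be] al)[al1|[<-|//]]; first exact: cl1.
by apply: (cll (be, f)); left.
Qed.

Lemma vecU1 v A j : j \notin A -> v + vec A + vec [set j] = v + vec (j |: A).
Proof.
move=> jA; rewrite -addrA; congr (_ + _); apply/ffunP => i; rewrite !ffunE !inE.
by case: eqP => [->|_]; rewrite ?(negPf jA) ?add0r ?addr0.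
Qed.

(** A product on the cube at [v] evaluates its factors only on edges of that cube, so one factor
    vanishing on these edges kills it. *)
Lemma cup_vanish v s al S : List.In al s ->
  (forall A j, j \notin A -> al j (v + vec A) = 0) -> cup s one_form S v = 0.
Proof.
move=> als al0.
(* [A] holds the directions used up by earlier factors, [T] those still to be used. *)
suff H A (T : {set 'I_n}) : [disjoint A & T] -> cup s one_form T (v + vec A) = 0.
  have := H finset.set0 S; rewrite finset.disjoints_subset finset.sub0set => /(_ isT).
  suff -> : vec finset.set0 = 0 by rewrite addr0.
  by apply/ffunP => i; rewrite !ffunE inE.
elim: s als A T => //= be s ih als A T dAT; apply: big1 => j jT.
have jA : j \notin A by rewrite (disjointFl dAT).
case: als => [->|als]; first by rewrite al0 ?mul0r.
rewrite vecU1 // ih ?mulr0 //.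
rewrite finset.disjoints_subset; apply/fintype.subsetP => x; rewrite !inE negb_and negbK.
by case/orP => [->//|xA]; rewrite (disjointFr dAT xA) orbT.
Qed.

(** The class of the [m]-th circle factor, represented by a cut: it counts the edges in direction
    [m] that wrap from [-1] to [0]. *)
Definition winding_cochain (m : 'I_n) : cochain :=
  fun j v => ((j == m) && (v j == -1))%:R.

Lemma vec1E (v : V) (i j : 'I_n) : i != j -> (v + vec [set i]) j = v j.
Proof. by move=> ij; rewrite !ffunE inE eq_sym (negPf ij) addr0. Qed.

Lemma winding_closed m : closed_cochain (winding_cochain m).
Proof.
move=> i j v; rewrite /winding_cochain; have [->//|ij] := eqVneq i j.
by rewrite !vec1E // 1?eq_sym // addrC.
Qed.

(** The factor of index [m] accepts only the direction [m], so a single ordering of the directions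
    contributes. *)
Lemma cup_winding (s : seq 'I_n) v : uniq s ->
  cup [seq winding_cochain m | m <- s] one_form [set x in s] v =
  \prod_(m <- s) (v m == -1)%:R.
Proof.
elim: s v => [|m s ih] v /=.
  have -> : [set x in [::]] = finset.set0 :> {set 'I_n} by apply/setP => x; rewrite !inE.
  by rewrite big_nil /one_form eqxx.
move=> /andP[ms us]; rewrite big_cons /wedge (bigD1 m) ?inE ?eqxx //=.
rewrite big1 ?addr0; last first.
  by move=> j /andP[_ /negPf jm]; rewrite /winding_cochain jm mul0r.
rewrite {1}/winding_cochain eqxx /=; congr (_ * _).
have -> : [set x in m :: s] :\ m = [set x in s].
  apply/setP => x; rewrite !inE.
  by have [->|] := eqVneq x m; rewrite ?(negPf ms).
rewrite ih //; apply: eq_big_seq => j js; rewrite vec1E //.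
by apply: contraNneq ms => ->.
Qed.

Lemma total_cup_winding :
  total (cup [seq winding_cochain m | m <- enum 'I_n] one_form) = 1.
Proof.
rewrite /total; have eT : [set: 'I_n] = [set x in enum 'I_n].
  by apply/setP => x; rewrite !inE mem_enum.
(* Only the cube at which every coordinate wraps contributes. *)
rewrite (bigD1 [ffun=> -1]) //= big1 => [|v vN]; rewrite eT cup_winding ?enum_uniq //.
  by rewrite addr0 big1 // => i _; rewrite ffunE eqxx.
have [i vi] : exists i, v i != -1.
  apply/existsP; apply: contraNT vN => /existsPn h; apply/eqP/ffunP => i.
  by rewrite ffunE; apply/eqP; have := h i; rewrite negbK.
by rewrite big_enum /= (bigD1 i) //= (negPf vi) mul0r.
Qed.

(* The cup product of the [n] coordinate classes of the torus is its nonzero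
   top class, so it has no representative vanishing on every small cube. *)
Lemma torus_cup_nonzero (f : 'I_n -> V -> 'F_2) :
  ~ forall v, exists i, forall A j, j \notin A ->
      winding_cochain i j (v + vec A) + coboundary (f i) j (v + vec A) = 0.
Proof.
move=> h; have := oner_neq0 'F_2; rewrite -total_cup_winding => /eqP; apply.
pose l := [seq (winding_cochain m, f m) | m <- enum 'I_n].
have -> : [seq winding_cochain m | m <- enum 'I_n] = [seq p.1 | p <- l].
  by rewrite /l -map_comp.
rewrite -(@total_cup_perturb [::] l) //=; last first.
  by move=> p /List.in_map_iff [m [<- _]]; exact: winding_closed.
(* On each cube some perturbed factor vanishes, hence so does the perturbed product. *)
apply: big1 => v _; have [i hi] := h v.
pose al := addcochain (winding_cochain i) (coboundary (f i)).
apply: (@cup_vanish _ _ al); last by move=> A j; exact: hi.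
suff H s : i \in s ->
    List.In al [seq addcochain (winding_cochain m) (coboundary (f m)) | m <- s].
  by rewrite /l -map_comp; apply: H; rewrite mem_enum.
elim: s => [//|x s ih]; rewrite in_cons => /orP[/eqP <-|is_]; first by left.
by right; apply: ih.
Qed.

End CubicalCochains.

Local Open Scope classical_set_scope.
Local Open Scope ring_scope.

(** * Rotations of the circle *)

Section Circle.
Variable R : realType.

Local Notation C := (set_type (@circle R)).
Implicit Types (z w : C) (s t : R).

Definition cx z : R := (set_val z).1.
Definition cy z : R := (set_val z).2.

Lemma circle_eq z : cx z ^+ 2 + cy z ^+ 2 = 1.
Proof. exact: set_valP z. Qed.

Lemma circle_inj z w : cx z = cx w -> cy z = cy w -> z = w.
Proof.
case: z w => [[a b] p] [[c d] q]; rewrite /cx /cy /= => ac bd.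
by apply: val_inj => /=; rewrite ac bd.
Qed.

Lemma rot_mem z t :
  (cx z * cos t - cy z * sin t, cx z * sin t + cy z * cos t) \in @circle R.
Proof.
rewrite inE /circle /=; have := circle_eq z; have := cos2Dsin2 t.
move: (cx z) (cy z) (cos t) (sin t) => x y c s h1 h2.
have -> : (x * c - y * s) ^+ 2 + (x * s + y * c) ^+ 2 =
          (x ^+ 2 + y ^+ 2) * (c ^+ 2 + s ^+ 2) by ring.
by rewrite h1 h2 mul1r.
Qed.

Definition rot z t : C :=
  exist (fun p : R * R => p \in @circle R) _ (rot_mem z t).

Lemma cx_rot z t : cx (rot z t) = cx z * cos t - cy z * sin t.
Proof. by []. Qed.

Lemma cy_rot z t : cy (rot z t) = cx z * sin t + cy z * cos t.
Proof. by []. Qed.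

Lemma rot0 z : rot z 0 = z.
Proof.
by apply: circle_inj; rewrite ?cx_rot ?cy_rot cos0 sin0 !(mulr0, mulr1) ?subr0 ?add0r.
Qed.

Lemma rotD z s t : rot z (s + t) = rot (rot z s) t.
Proof.
apply: circle_inj; rewrite !(cx_rot, cy_rot) sinD cosD; ring.
Qed.

(** [dot] and [cross] are the cosine and the sine of the angle from [z] to [w]. *)
Definition dot z w := cx z * cx w + cy z * cy w.
Definition cross z w := cx z * cy w - cy z * cx w.

Lemma dot_sqr_cross z w : dot z w ^+ 2 + cross z w ^+ 2 = 1.
Proof.
have -> : dot z w ^+ 2 + cross z w ^+ 2 =
  (cx z ^+ 2 + cy z ^+ 2) * (cx w ^+ 2 + cy w ^+ 2) by rewrite /dot /cross; ring.
by rewrite !circle_eq mul1r.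
Qed.

Lemma dot_refl z : dot z z = 1.
Proof. by rewrite -(circle_eq z) !expr2. Qed.

Lemma cross_refl z : cross z z = 0.
Proof. by rewrite /cross mulrC subrr. Qed.

Lemma dotC z w : dot z w = dot w z.
Proof. by rewrite /dot; ring. Qed.

Lemma dot_rot z t : dot z (rot z t) = cos t.
Proof.
rewrite -[RHS]mul1r -(circle_eq z) /dot !(cx_rot, cy_rot); ring.
Qed.

Lemma cross_rot z t : cross z (rot z t) = sin t.
Proof.
rewrite -[RHS]mul1r -(circle_eq z) /cross !(cx_rot, cy_rot); ring.
Qed.

Lemma rot_dot_cross z w t : cos t = dot z w -> sin t = cross z w -> rot z t = w.
Proof.
move=> ct st; apply: circle_inj; rewrite !(cx_rot, cy_rot) ct st.
  by rewrite -[RHS]mul1r -(circle_eq z) /dot /cross; ring.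
by rewrite -[RHS]mul1r -(circle_eq z) /dot /cross; ring.
Qed.

Lemma dot_le1 z w : dot z w <= 1.
Proof.
have := dot_sqr_cross z w; have := sqr_ge0 (cross z w).
by move: (dot z w) (cross z w ^+ 2) => d c; nra.
Qed.

Lemma dot_geN1 z w : -1 <= dot z w.
Proof.
have := dot_sqr_cross z w; have := sqr_ge0 (cross z w).
by move: (dot z w) (cross z w ^+ 2) => d c; nra.
Qed.

Lemma dot_eq1 z w : dot z w = 1 -> z = w.
Proof.
move=> d1; have := dot_sqr_cross z w; rewrite d1 expr1n => h.
have c0 : cross z w = 0.
  by apply/eqP; rewrite -sqrf_eq0; apply/eqP; move: h; lra.
by rewrite -(@rot_dot_cross z w 0) ?rot0 ?cos0 ?sin0.
Qed.

Lemma dot_lt1 z w : z <> w -> dot z w < 1.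
Proof.
move=> zw; rewrite lt_neqAle dot_le1 andbT; apply/eqP => /dot_eq1 //.
Qed.

(* The angle from [z] to [w] in ]-pi, pi[; junk when [w] is antipodal to [z]. *)
Definition ang z w : R := 2 * atan (cross z w / (1 + dot z w)).

(** Half-angle formulas: [u] is the tangent of half the angle, and [1 + dot z w] is twice the square
    of its cosine. *)
Lemma rot_ang z w : 1 + dot z w != 0 -> rot z (ang z w) = w.
Proof.
move=> d0; set u := cross z w / (1 + dot z w).
have a0 : 0 < 1 + u ^+ 2 by rewrite ltr_pwDl // sqr_ge0.
have c2 : cos (atan u) ^+ 2 = (1 + u ^+ 2)^-1.
  by rewrite cos_atan exprVn sqr_sqrtr // ltW.
have cne : cos (atan u) != 0.
  by rewrite -sqrf_eq0 c2 invr_eq0 gt_eqF.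
have su : sin (atan u) = u * cos (atan u).
  by rewrite -{2}(atanK u) /tan mulrVK // unitfE.
have h := dot_sqr_cross z w.
have du : (1 + dot z w) * (1 + u ^+ 2) = 2.
  rewrite /u; move: h d0; move: (dot z w) (cross z w) => d c h d0.
  have e : c ^+ 2 = (1 - d) * (1 + d).
    have -> : (1 - d) * (1 + d) = 1 - d ^+ 2 by ring.
    by lra.
  have -> : (1 + d) * (1 + (c / (1 + d)) ^+ 2) = (1 + d) + c ^+ 2 / (1 + d).
    by field.
  by rewrite e mulfK //; ring.
have iu : (1 + u ^+ 2)^-1 = (1 + dot z w) / 2.
  by rewrite -du; field; rewrite d0 gt_eqF.
have -> : ang z w = atan u *+ 2 by rewrite mulr2n /ang -/u; ring.
apply: rot_dot_cross.
  by rewrite cos_mulr2n c2 iu; field.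
rewrite sin_mulr2n su mulrCA -expr2 c2 iu /u.
by field.
Qed.

Lemma ang_refl z : ang z z = 0.
Proof. by rewrite /ang cross_refl mul0r atan0 mulr0. Qed.

Lemma ang_rot z t : `|t| < pi -> ang z (rot z t) = t.
Proof.
move=> tpi; have ht : t / 2 \in `](- (pi / 2)), (pi / 2)[.
  by rewrite in_itv /=; move: tpi; rewrite ltr_norml => /andP[? ?]; lra.
have c0 : cos (t / 2) != 0.
  by rewrite gt_eqF // cos_gt0_pihalf //; move: ht; rewrite in_itv.
rewrite /ang dot_rot cross_rot.
have -> : sin t / (1 + cos t) = tan (t / 2).
  have -> : t = (t / 2) *+ 2 by rewrite mulr2n; field.
  rewrite sin_mulr2n cos_mulr2n /tan.
  have -> : (t / 2) *+ 2 / 2 = t / 2 by rewrite mulr2n; field.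
  move: c0; move: (cos _) (sin _) => c s c0.
  have -> : 1 + (c ^+ 2 *+ 2 - 1) = 2 * c ^+ 2 by rewrite mulr2n; ring.
  by rewrite mulr2n; field.
by rewrite tanK //; field.
Qed.

Lemma cos_sinD2pi_int (k : int) t :
  cos (t + k%:~R * (2 * pi)) = cos t /\ sin (t + k%:~R * (2 * pi)) = sin t.
Proof.
have E (m : nat) : m%:R * (2 * pi) = (pi *+ 2) *+ m :> R.
  by rewrite -[RHS]mulr_natl -[pi *+ 2]mulr_natl.
have P (m : nat) (a : R) : cos (a + m%:R * (2 * pi)) = cos a /\
                     sin (a + m%:R * (2 * pi)) = sin a.
  by rewrite E (periodicn (@cosD2pi R)) (periodicn (@sinD2pi R)).
case: k => m; first by rewrite -pmulrn; exact: P.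
rewrite NegzE mulrNz mulNr -pmulrn.
by have [<- <-] := P m.+1 (t - m.+1%:R * (2 * pi)); rewrite subrK.
Qed.

Lemma cos_eq1 t : cos t = 1 -> exists k : int, t = k%:~R * (2 * pi).
Proof.
move=> c1; have p2 : 0 < 2 * pi :> R by rewrite mulr_gt0 // pi_gt0.
(* Removing [k] full turns leaves [u] between 0 and [2 * pi], where [sin (u / 2)] vanishes only at
   [u = 0]. *)
pose k := Num.floor (t / (2 * pi)); exists k.
have lo : k%:~R * (2 * pi) <= t by rewrite -ler_pdivlMr // floor_le_tmp.
have hi : t < (k + 1)%:~R * (2 * pi) by rewrite -ltr_pdivrMr // floorD1_gt.
rewrite intrD mulrDl mul1r in hi.
pose u := t - k%:~R * (2 * pi).
have cu : cos u = 1.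
  by rewrite -c1 -[in RHS](subrK (k%:~R * (2 * pi)) t) (cos_sinD2pi_int k _).1.
have : sin (u / 2) ^+ 2 = 0.
  have : u = (u / 2) *+ 2 by rewrite mulr2n; field.
  move=> eu; move: cu; rewrite {1}eu cos_mulr2n cos2sin2 mulr2n => h.
  by lra.
move=> /eqP; rewrite sqrf_eq0 => /eqP s0.
apply/eqP; rewrite -subr_eq0 -/u; apply/eqP; apply: contrapT => /eqP u0.
have ugt0 : 0 < u by rewrite lt_neqAle eq_sym u0 subr_ge0.
have : 0 < sin (u / 2).
  apply: sin_gt0_pi; rewrite divr_gt0 //= ltr_pdivrMr // /u.
  by rewrite ltrBlDl [pi * 2]mulrC.
by rewrite s0 ltxx.
Qed.

Lemma rot_int z (k : int) : rot z (k%:~R * (2 * pi)) = z.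
Proof.
have [c s] := cos_sinD2pi_int k 0; rewrite add0r cos0 sin0 in c s.
by apply: rot_dot_cross; rewrite ?c ?s ?dot_refl ?cross_refl.
Qed.

Lemma rot_inj z s t : rot z s = rot z t ->
  exists k : int, t - s = k%:~R * (2 * pi).
Proof.
move=> h; apply: cos_eq1; rewrite -(dot_rot (rot z s)) -rotD.
by rewrite addrC subrK h dot_refl.
Qed.

End Circle.

(** * Continuity of the operations on the circle and of maps into products *)

Section Continuity.
Variable R : realType.
Local Notation C := (set_type (@circle R)).
Implicit Types (T : topologicalType).

Lemma cvg_set_type T (Y : topologicalType) (A : set Y) (f : T -> set_type A) x :
  {for x, continuous (fun t => set_val (f t))} -> {for x, continuous f}.
Proof.
move=> cf U [?/= [[W oW <-]]] /= Wfx /filterS; apply; apply: cf.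
exact: open_nbhs_nbhs.
Qed.

Lemma continuous_set_val (Y : topologicalType) (A : set Y) :
  continuous (set_val : set_type A -> Y).
Proof. exact: initial_continuous. Qed.

Lemma continuous_for_comp T T' T'' (f : T -> T') (g : T' -> T'') x :
  {for x, continuous f} -> {for f x, continuous g} ->
  {for x, continuous (fun t => g (f t))}.
Proof. by move=> cf cg; apply: continuous_comp. Qed.

Lemma continuous_for_pair T T' T'' (f : T -> T') (g : T -> T'') x :
  {for x, continuous f} -> {for x, continuous g} ->
  {for x, continuous (fun t => (f t, g t))}.
Proof. by move=> cf cg; exact: (cvg_pair cf cg). Qed.

Lemma continuous_cx : continuous (@cx R).
Proof.
move=> z; apply: (@continuous_for_comp _ _ _ set_val fst).
  exact: continuous_set_val.
exact: cvg_fst.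
Qed.

Lemma continuous_cy : continuous (@cy R).
Proof.
move=> z; apply: (@continuous_for_comp _ _ _ set_val snd).
  exact: continuous_set_val.
exact: cvg_snd.
Qed.

Lemma cvg_circle T (f : T -> C) x :
  {for x, continuous (fun t => cx (f t))} ->
  {for x, continuous (fun t => cy (f t))} -> {for x, continuous f}.
Proof.
move=> c1 c2; apply: cvg_set_type.
rewrite (_ : (fun t => set_val (f t)) = (fun t => (cx (f t), cy (f t)))).
  exact: (cvg_pair c1 c2).
by apply/funext => t; rewrite /cx /cy; case: (set_val (f t)).
Qed.

Lemma cvg_rot T (f : T -> C) (g : T -> R) x :
  {for x, continuous f} -> {for x, continuous g} ->
  {for x, continuous (fun t => rot (f t) (g t))}.
Proof.
move=> cf cg.
apply: cvg_circle; rewrite /continuous_at.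
  apply: cvgB; apply: cvgM.
  - exact: (continuous_for_comp cf (@continuous_cx _)).
  - exact: (continuous_for_comp cg (@continuous_cos _ _)).
  - exact: (continuous_for_comp cf (@continuous_cy _)).
  - exact: (continuous_for_comp cg (@continuous_sin _ _)).
apply: cvgD; apply: cvgM.
- exact: (continuous_for_comp cf (@continuous_cx _)).
- exact: (continuous_for_comp cg (@continuous_sin _ _)).
- exact: (continuous_for_comp cf (@continuous_cy _)).
- exact: (continuous_for_comp cg (@continuous_cos _ _)).
Qed.

Lemma cvg_dot T (f g : T -> C) x :
  {for x, continuous f} -> {for x, continuous g} ->
  {for x, continuous (fun t => dot (f t) (g t))}.
Proof.
move=> cf cg; apply: cvgD; apply: cvgM.
- exact: (continuous_for_comp cf (@continuous_cx _)).
- exact: (continuous_for_comp cg (@continuous_cx _)).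
- exact: (continuous_for_comp cf (@continuous_cy _)).
- exact: (continuous_for_comp cg (@continuous_cy _)).
Qed.

Lemma cvg_cross T (f g : T -> C) x :
  {for x, continuous f} -> {for x, continuous g} ->
  {for x, continuous (fun t => cross (f t) (g t))}.
Proof.
move=> cf cg; apply: cvgB; apply: cvgM.
- exact: (continuous_for_comp cf (@continuous_cx _)).
- exact: (continuous_for_comp cg (@continuous_cy _)).
- exact: (continuous_for_comp cf (@continuous_cy _)).
- exact: (continuous_for_comp cg (@continuous_cx _)).
Qed.

Lemma cvg_ang T (f g : T -> C) x :
  {for x, continuous f} -> {for x, continuous g} ->
  1 + dot (f x) (g x) != 0 ->
  {for x, continuous (fun t => ang (f t) (g t))}.
Proof.
move=> cf cg d0; apply: cvgM; first exact: cvg_cst.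
have cq : {for x, continuous (fun t => cross (f t) (g t) / (1 + dot (f t) (g t)))}.
  apply: cvgM; first exact: cvg_cross.
  apply: cvgV => //; apply: cvgD; first exact: cvg_cst.
  exact: cvg_dot.
exact: (continuous_for_comp cq (@continuous_atan _ _)).
Qed.

Lemma cvg_ptws T (I : Type) (Y : topologicalType) (f : T -> {ptws I -> Y}) x :
  (forall i, {for x, continuous (fun t => f t i)}) -> {for x, continuous f}.
Proof.
move=> cf; apply/cvg_sup => i U [?/= [[W oW <-]]] /= Wfx /filterS; apply.
by apply: cf; exact: open_nbhs_nbhs.
Qed.

Lemma continuous_ptws_proj (n : nat) (Y : topologicalType) (i : 'I_n) :
  continuous (fun f : {ptws 'I_n -> Y} => f i).
Proof. by move=> f; exact: (@proj_continuous _ (fun=> Y) i). Qed.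

End Continuity.

(** * Lifting paths of the circle *)

Section Winding.
Variable R : realType.
Local Notation C := (set_type (@circle R)).
Implicit Types (r : R -> C) (w t : R).

(** Otherwise the intermediate value theorem would produce a value [k + 1 / 2] with [k] an
    integer. *)
Lemma integer_valued_const (f : R -> R) : {within `[0, 1], continuous f} ->
  (forall t, 0 <= t <= 1 -> exists k : int, f t = k%:~R) -> f 0 = f 1.
Proof.
suff H (g : R -> R) : {within `[0, 1], continuous g} ->
    (forall t, 0 <= t <= 1 -> exists k : int, g t = k%:~R) -> g 1 <= g 0.
  move=> cf fi; apply/eqP; rewrite eq_le H // andbT -lerN2.
  apply: (H (fun t => - f t)).
    by move=> t; apply: cvgN; exact: cf.
  by move=> t /fi [k ->]; exists (- k); rewrite mulrNz.
move=> cg gi; rewrite leNgt; apply/negP => lt01.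
have [k gk] := gi 0 (ltac:(by rewrite lexx ler01)).
have [m gm] := gi 1 (ltac:(by rewrite lexx ler01)).
have km : (k + 1 <= m)%R by move: lt01; rewrite gk gm ltr_int lezD1.
have km' : k%:~R + 1 <= m%:~R :> R by rewrite -[1]/(1%:~R) -intrD ler_int.
have [|c c01 gc] := @IVT R g 0 1 (k%:~R + 1 / 2) ler01 cg.
  rewrite gk gm minElt maxElt ltr_int; have -> : (k < m)%R by rewrite -lezD1.
  by apply/andP; split; lra.
move: c01; rewrite in_itv /= => /gi [j gj].
have kj : k%:~R < j%:~R :> R by rewrite -gj gc; lra.
have jk : j%:~R < (k + 1)%:~R :> R by rewrite -gj gc intrD; lra.
by move: kj jk; rewrite !ltr_int ltzD1 => kj /(lt_le_trans kj); rewrite ltxx.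
Qed.

(** The total signed angle, in radians, swept by [r], read off a lift starting at 0; [r] need not be
    closed, so [w] need not be a whole number of turns. *)
Definition winds r w := exists l : R -> R,
  [/\ {within `[0, 1], continuous l}, l 0 = 0, l 1 = w
    & forall t, 0 <= t <= 1 -> r t = rot (r 0) (l t)].

(** Two lifts differ by a continuous whole number of turns, which is constant. *)
Lemma winds_uniq r w w' : winds r w -> winds r w' -> w = w'.
Proof.
move=> [l [cl l0 <- lr]] [l' [cl' l'0 <- l'r]].
have p0 : (2 * pi : R) != 0 by rewrite mulf_neq0 ?pnatr_eq0 // gt_eqF // pi_gt0.
pose d t := (l t - l' t) / (2 * pi).
have : d 0 = d 1.
  apply: integer_valued_const => [t|t t01].
    apply: cvgM; last exact: cvg_cst.
    by apply: cvgB; [exact: cl|exact: cl'].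
  have := lr t t01; rewrite l'r // => /rot_inj [k dk].
  by exists k; rewrite /d dk mulfK.
rewrite /d l0 l'0 subrr mul0r => /esym/eqP.
by rewrite mulf_eq0 invr_eq0 (negPf p0) orbF subr_eq0 => /eqP.
Qed.

Lemma continuous_at_within (f : R -> R) (A : set R) :
  (forall t, A t -> {for t, continuous f}) -> {within A, continuous f}.
Proof.
by move=> cf; apply: continuous_in_subspaceT => t; rewrite inE; exact: cf.
Qed.

(** Adding the angle from [r t] to [r' t], continuous because the two are never antipodal, turns a
    lift of [r] into one of [r']. *)
Lemma winds_perturb r r' w : continuous r -> continuous r' ->
  (forall t, 0 <= t <= 1 -> 1 + dot (r t) (r' t) != 0) -> winds r w ->
  winds r' (w + ang (r 1) (r' 1) - ang (r 0) (r' 0)).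
Proof.
move=> cr cr' d0 [l [cl l0 l1 lr]].
pose a t := ang (r t) (r' t).
have ca : {within `[0, 1], continuous a}.
  apply: continuous_at_within => t /=; rewrite in_itv /= => t01.
  by apply: cvg_ang; [exact: cr|exact: cr'|exact: d0].
exists (fun t => l t + a t - a 0); split => //.
- move=> t; apply: cvgB; last exact: cvg_cst.
  by apply: cvgD; [exact: cl|exact: ca].
- by rewrite l0 add0r subrr.
- by rewrite l1.
have r'E t : 0 <= t <= 1 -> r' t = rot (r 0) (l t + a t).
  by move=> t01; rewrite rotD -lr // rot_ang // d0.
move=> t t01; rewrite (r'E t) // (r'E 0) ?lexx ?ler01 // l0 add0r -rotD.
by congr rot; ring.
Qed.

(** Uniform continuity on a compact interval: at close times the points are less than a quarter turn
    apart. *)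
Lemma uniform_dot_gt0 r : continuous r -> exists N : nat, forall s t,
  0 <= t <= 1 -> `|s - t| <= N.+1%:R^-1 -> 0 < dot (r s) (r t).
Proof.
move=> cr.
have /compact_near_coveringP cpt := @segment_compact R 0 1.
pose P (N : nat) t := forall s, `|s - t| <= N.+1%:R^-1 -> 0 < dot (r s) (r t).
have [|N _ HN] := cpt nat \oo P _; last first.
  exists N => s t t01 st; apply: (HN N _ t _ s st) => /=; rewrite ?in_itv //=.
move=> t _.
have cd : {for (t, t), continuous (fun p : R * R => dot (r p.1) (r p.2))}.
  apply: cvg_dot.
    exact: (continuous_for_comp (f := fst) (@cvg_fst _ _ _ _ _) (cr _)).
  exact: (continuous_for_comp (f := snd) (@cvg_snd _ _ _ _ _) (cr _)).
have : \forall p \near (t, t), 0 < dot (r p.1) (r p.2).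
  have h : 0 < dot (r (t, t).1) (r (t, t).2) by rewrite /= dot_refl.
  exact: (cd _ (lt_nbhsr h)).
move=> /nbhs_ballP[e /= e0 He].
exists (ball t (e / 2), [set N : nat | N.+1%:R^-1 < e / 2]).
  split; first by apply: nbhsx_ballx; rewrite divr_gt0.
  by apply: near_infty_natSinv_lt (PosNum (divr_gt0 e0 (ltr0Sn _ 1))).
move=> [t' N] /= [tt' Ne] s st'; apply: (He (s, t')).
have tt2 : `|t - t'| < e / 2 := tt'.
split; rewrite /= /ball /=; last by rewrite (lt_trans tt2) // ltr_pdivrMr // ltr_pMr // ltr1n.
rewrite (_ : t - s = (t - t') + - (s - t')); last by ring.
rewrite (le_lt_trans (ler_normD _ _)) // normrN.
by rewrite (splitr e) ltrD // (le_lt_trans st').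
Qed.

(** The lift adds up the angles between consecutive sample points. Stopping the sample times [k / N]
    at [t] makes the summands beyond [t] vanish, so that one formula is continuous on the whole
    interval. *)
Lemma winds_exists r : continuous r -> exists w, winds r w.
Proof.
move=> cr; have [M HM] := uniform_dot_gt0 cr; pose N := M.+1.
pose c k t : R := Num.min t (k%:R / N%:R).
pose l t := \sum_(k < N) ang (r (c k t)) (r (c k.+1 t)).
have N0 : 0 < N%:R :> R by rewrite ltr0n.
have c01 k t : 0 <= t <= 1 -> 0 <= c k t <= 1.
  move=> /andP[t0 t1]; rewrite /c le_min t0 ge_min t1 /= andbT.
  by rewrite divr_ge0.
have d0 k t : 0 <= t <= 1 -> 1 + dot (r (c k t)) (r (c k.+1 t)) != 0.
  move=> t01; rewrite gt_eqF // addr_gt0 // HM ?c01 //.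
  have -> : M.+1%:R^-1 = k.+1%:R / N%:R - k%:R / N%:R :> R.
    by rewrite -mulrBl -natrB // subSnn div1r.
  have kk : k%:R / N%:R <= k.+1%:R / N%:R :> R.
    by rewrite ler_pM2r ?invr_gt0 // ler_nat.
  rewrite distrC ger0_norm; rewrite /c; first by case: (leP t) => ?; case: (leP t) => ?; lra.
  by case: (leP t) => ?; case: (leP t) => ?; lra.
exists (l 1), l; split => //.
- apply: continuous_at_within => t /=; rewrite in_itv /= => t01.
  have cc k : {for t, continuous (fun t => r (c k t))}.
    apply: (continuous_for_comp (f := c k) _ (cr _)).
    apply: (@continuous_min R R (fun t => t) (fun=> k%:R / N%:R)).
      exact: cvg_id.
    exact: cvg_cst.
  apply: cvg_big => [|k _]; first exact: add_continuous.
  by apply: cvg_ang; rewrite ?d0.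
- apply: big1 => k _; have c0 j : c j 0 = 0.
    by rewrite /c; apply/min_idPl; rewrite divr_ge0.
  by rewrite !c0 ang_refl.
move=> t t01; have H j : (j <= N)%N ->
    r (c j t) = rot (r 0) (\sum_(k < j) ang (r (c k t)) (r (c k.+1 t))).
  elim: j => [_|j ih jN].
    rewrite big_ord0 rot0 /c mul0r (_ : Num.min t 0 = 0) //.
    by apply/min_idPr; case/andP: t01.
  by rewrite big_ord_recr /= rotD -ih ?rot_ang ?d0 // ltnW.
have e : c N t = t.
  by rewrite /c divff ?gt_eqF //; apply/min_idPl; case/andP: t01.
by rewrite -[in LHS]e H.
Qed.

End Winding.

(** * Paths and homotopies *)

Section PathSpace.
Variable R : realType.
Local Notation I := (unit_interval R).

Lemma clamp_mem (t : R) : Num.max 0 (Num.min t 1) \in (`[0, 1]%classic : set R).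
Proof. by rewrite inE /= in_itv /= le_max lexx /= ge_max ler01 ge_min lexx orbT. Qed.

(** Retraction of the line onto the interval; it extends paths to all real times, as the lifting
    lemmas require. *)
Definition clamp (t : R) : I := exist (fun t : R => t \in `[0, 1]%classic) _ (clamp_mem t).

Lemma clamp_val (t : I) : clamp (set_val t) = t.
Proof.
apply: val_inj; rewrite /= -set_valE.
have := set_valP t; rewrite /= in_itv /= => /andP[t0 t1].
by rewrite (min_idPl t1) (max_idPr t0).
Qed.

Lemma clamp0 : clamp 0 = time0 R.
Proof. by apply: val_inj; rewrite /= (min_idPl ler01) maxxx. Qed.

Lemma clamp1 : clamp 1 = time1 R.
Proof. by apply: val_inj; rewrite /= minxx (max_idPr ler01). Qed.

Lemma continuous_clamp : continuous clamp.
Proof.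
move=> t; apply: cvg_set_type.
apply: (@continuous_max R R (fun=> 0) (fun t => Num.min t 1)).
  exact: cvg_cst.
apply: (@continuous_min R R (fun t => t) (fun=> 1)); first exact: cvg_id.
exact: cvg_cst.
Qed.

Lemma unit_interval_compact : compact [set: I].
Proof.
have -> : [set: I] = clamp @` `[0, 1]%classic.
  apply/seteqP; split => // t _; exists (set_val t); last exact: clamp_val.
  exact: set_valP.
apply: continuous_compact; last exact: segment_compact.
exact/continuous_subspaceT/continuous_clamp.
Qed.

Lemma unit_interval_hausdorff : hausdorff_space I.
Proof.
move=> x y xy; apply: val_inj; rewrite -!set_valE.
apply: Rhausdorff => U V Ux Vy.
have [||z [Uz Vz]] := xy (set_val @^-1` U) (set_val @^-1` V).
- exact: (@continuous_set_val _ _ x U Ux).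
- exact: (@continuous_set_val _ _ y V Vy).
by exists (set_val z).
Qed.

Lemma unit_interval_locally_compact : locally_compact [set: I].
Proof.
move=> x _; exists setT; first by rewrite withinET; exact: filterT.
by split; [exact: unit_interval_compact|exact: closedT].
Qed.

(** Exponential law for the compact-open topology: the interval is locally compact and Hausdorff. *)
Lemma continuous_path_eval (T X : topologicalType) (s : T -> path_space R X) :
  continuous s -> continuous (fun p : T * I => path_fun (s p.1) p.2).
Proof.
move=> cs.
have -> : (fun p : T * I => path_fun (s p.1) p.2) =
    uncurry (fun z => path_fun (s z) : I -> X) by apply/funext => -[].
apply: continuous_uncurry.
- exact: unit_interval_locally_compact.
- exact: unit_interval_hausdorff.
- move=> z; apply: (@continuous_for_comp T (path_space R X)
    {compact-open, I -> X} s (@path_fun R X)); first exact: cs.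
  exact: initial_continuous.
- by move=> z; exact: (@cts_fun _ _ (s z)).
Qed.

Lemma path_of_homotopy (T X : topologicalType) (H : T * I -> X) :
  continuous H -> exists s : T -> path_space R X,
    continuous s /\ forall z t, path_fun (s z) t = H (z, t).
Proof.
move=> cH; have [cc cu] := continuous_curry cH.
exists (fun z => mkcts (cu z) : continuousType I X); split => //.
by apply: continuous_comp_initial; exact: cc.
Qed.

End PathSpace.

(** * Connectedness of the configuration space *)

Section Configurations.
Variables (R : realType) (n : nat) (a b : set_type (@circle R)).
Local Notation C := (set_type (@circle R)).
Local Notation X := (set_type (@anchored_conf R n [set a; b])).
Local Notation conf := ('I_n -> C).
Implicit Types (p q : conf).

Definition anchored p := (exists i, p i = a) /\ (exists i, p i = b).

Lemma anchored_mem p : anchored p -> (p : {ptws 'I_n -> C}) \in @anchored_conf R n [set a; b].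
Proof.
move=> [[i pi] [j pj]]; rewrite inE /anchored_conf /= => z [->|->].
  by exists i.
by exists j.
Qed.

Definition mkX p (hp : anchored p) : X :=
  exist (fun p : {ptws 'I_n -> C} => p \in @anchored_conf R n [set a; b]) _ (anchored_mem hp).

Lemma mkXE p (hp : anchored p) : set_val (mkX hp) = p.
Proof. by []. Qed.

Lemma anchored_val (x : X) : anchored (set_val x).
Proof.
have := set_valP x; rewrite /anchored_conf /= => h; split.
  by have [|i _ xi] := h a; [left|exists i].
by have [|i _ xi] := h b; [right|exists i].
Qed.

Lemma cvg_conf (T : topologicalType) (f : T -> X) x :
  (forall i, {for x, continuous (fun t => set_val (f t) i)}) ->
  {for x, continuous f}.
Proof. by move=> cf; apply: cvg_set_type; apply: cvg_ptws. Qed.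

Lemma continuous_coord (i : 'I_n) : continuous (fun x : X => (set_val x : conf) i).
Proof.
move=> x; exact: (continuous_for_comp (f := set_val)
  (@continuous_set_val _ _ x) (@continuous_ptws_proj n C i _)).
Qed.

(* A path of configurations from [p] to [q], recorded by the angles through
   which the points turn. *)
Definition conf_path p q (psi : 'I_n -> R -> R) :=
  [/\ forall i, continuous (psi i), forall i, psi i 0 = 0,
      forall i, rot (p i) (psi i 1) = q i
    & forall t, 0 <= t <= 1 -> anchored (fun i => rot (p i) (psi i t))].

Definition joined p q := exists psi, conf_path p q psi.

Definition clip (t : R) : R := Num.max 0 (Num.min t 1).

Lemma clip_ge0 t : 0 <= clip t. Proof. by rewrite /clip le_max lexx. Qed.
Lemma clip_le1 t : clip t <= 1.
Proof. by rewrite /clip ge_max ler01 ge_min lexx orbT. Qed.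
Lemma clip01 t : 0 <= clip t <= 1. Proof. by rewrite clip_ge0 clip_le1. Qed.
Lemma clip_eq0 t : t <= 0 -> clip t = 0.
Proof.
by move=> t0; rewrite /clip; apply/max_idPl; rewrite ge_min t0.
Qed.
Lemma clip_eq1 t : 1 <= t -> clip t = 1.
Proof. by move=> t1; rewrite /clip (min_idPr t1) (max_idPr ler01). Qed.

Lemma continuous_clip : continuous clip.
Proof.
move=> t; apply: (@continuous_max R R (fun=> 0) (fun t => Num.min t 1)).
  exact: cvg_cst.
apply: (@continuous_min R R (fun t => t) (fun=> 1)); first exact: cvg_id.
exact: cvg_cst.
Qed.

Lemma continuous_affine (c d : R) : continuous (fun t : R => c * t + d).
Proof.
move=> t; apply: cvgD; last exact: cvg_cst.
by apply: cvgM; [exact: cvg_cst|exact: cvg_id].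
Qed.

Lemma continuous_compR (f g : R -> R) :
  continuous f -> continuous g -> continuous (fun t => g (f t)).
Proof. by move=> cf cg t; exact: (continuous_for_comp (cf t) (cg (f t))). Qed.

Lemma continuous_clip_affine (c d : R) : continuous (fun t : R => clip (c * t + d)).
Proof. exact: (continuous_compR (@continuous_affine c d) continuous_clip). Qed.

Lemma joined_refl p : anchored p -> joined p p.
Proof.
move=> ap; exists (fun _ _ => 0); split => //.
- by move=> i; exact: cst_continuous.
- by move=> i; rewrite rot0.
move=> t _; rewrite (_ : (fun i => rot (p i) 0) = p) //.
by apply/funext => i; rewrite rot0.
Qed.

Lemma joined_sym p q : joined p q -> joined q p.
Proof.
move=> [psi [c p0 p1 pa]].
have qE i t : rot (q i) (psi i (1 - t) - psi i 1) = rot (p i) (psi i (1 - t)).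
  by rewrite -p1 -rotD; congr rot; ring.
exists (fun i t => psi i (1 - t) - psi i 1); split.
- move=> i; rewrite (_ : (fun t => _) = (fun t => psi i (- 1 * t + 1) - psi i 1)).
    move=> t; apply: cvgB; last exact: cvg_cst.
    exact: (@continuous_compR (fun t => - 1 * t + 1) (psi i)
      (@continuous_affine _ _) (c i) t).
  by apply/funext => t; congr (psi i _ - _); ring.
- by move=> i; rewrite subr0 subrr.
- by move=> i; rewrite qE subrr p0 rot0.
move=> t /andP[t0 t1]; rewrite (_ : (fun i => _) = (fun i => rot (p i) (psi i (1 - t)))).
  by apply: pa; rewrite subr_ge0 t1 gerBl.
by apply/funext.
Qed.

(** The angles add: [clip] freezes [f] at its final value after half the time and keeps [g] at 0
    until then. *)
Lemma joined_trans p q r : joined p q -> joined q r -> joined p r.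
Proof.
move=> [f [cf f0 f1 fa]] [g [cg g0 g1 ga]].
exists (fun i t => f i (clip (2 * t + 0)) + g i (clip (2 * t + - 1))); split.
- move=> i t; apply: cvgD.
    exact: (@continuous_compR (fun t => clip (2 * t + 0)) (f i)
      (@continuous_clip_affine _ _) (cf i) t).
  exact: (@continuous_compR (fun t => clip (2 * t + - 1)) (g i)
      (@continuous_clip_affine _ _) (cg i) t).
- by move=> i; rewrite !clip_eq0 ?f0 ?g0 ?addr0 //; lra.
- by move=> i; rewrite !clip_eq1 ?rotD ?f1 ?g1 //; lra.
move=> t t01; have [th|th] := lerP t (1 / 2).
  have -> : (fun i => rot (p i) (f i (clip (2 * t + 0)) + g i (clip (2 * t + - 1)))) =
            (fun i => rot (p i) (f i (clip (2 * t + 0)))).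
    by apply/funext => i; rewrite (@clip_eq0 (2 * t + - 1)) ?g0 ?addr0 //; lra.
  exact/fa/clip01.
have -> : (fun i => rot (p i) (f i (clip (2 * t + 0)) + g i (clip (2 * t + - 1)))) =
          (fun i => rot (q i) (g i (clip (2 * t + - 1)))).
  by apply/funext => i; rewrite (@clip_eq1 (2 * t + 0)) ?rotD ?f1 //; lra.
exact/ga/clip01.
Qed.

Lemma rot_surj (z w : C) : exists t, rot z t = w.
Proof.
have [d0|d0] := eqVneq (1 + dot z w) 0; last by exists (ang z w); exact: rot_ang.
exists pi; have dN : dot z w = - 1 by lra.
apply: rot_dot_cross; rewrite ?cospi ?sinpi ?dN //.
have := dot_sqr_cross z w; rewrite dN => h; apply/esym/eqP; rewrite -sqrf_eq0.
by apply/eqP; move: h; rewrite sqrrN expr1n; lra.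
Qed.

(** Only point [m] turns, while two other points hold the anchors. *)
Lemma joined_move p q m : (forall i, i != m -> p i = q i) ->
  (exists2 i, i != m & p i = a) -> (exists2 i, i != m & p i = b) -> joined p q.
Proof.
move=> pq [i im pi] [j jm pj]; have [th eth] := rot_surj (p m) (q m).
exists (fun k t => if k == m then th * t + 0 else 0); split.
- by move=> k; case: eqP => _; [exact: continuous_affine|exact: cst_continuous].
- by move=> k; case: eqP; rewrite ?mulr0 ?addr0.
- move=> k; case: eqP => [->|/eqP km]; first by rewrite mulr1 addr0.
  by rewrite rot0 pq.
move=> t _; split; [exists i|exists j].
  by rewrite (negPf im) rot0.
by rewrite (negPf jm) rot0.
Qed.

Definition star (j : 'I_n) : conf := fun i => if i == j then b else a.

Hypothesis hab : a <> b.

Lemma joined_star p i j : p i = a -> p j = b -> joined p (star j).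
Proof.
move=> pi pj; have ij : i != j by apply/eqP => e; apply: hab; rewrite -pi -pj e.
have ap : anchored p by split; [exists i|exists j].
(* The configuration after the points listed in [s] have moved to [a]; [i] and [j] stay to hold the
   anchors. *)
pose ps (s : seq 'I_n) : conf := fun k =>
  if [&& k \in s, k != i & k != j] then a else p k.
suff H s : joined p (ps s).
  rewrite (_ : star j = ps (enum 'I_n)); first exact: H.
  apply/funext => k; rewrite /ps /star mem_enum /=.
  have [->|kj] := eqVneq k j; first by rewrite andbF pj.
  by have [->|_] /= := eqVneq k i; rewrite ?pi.
elim: s => [|m s ih].
  by rewrite (_ : ps [::] = p) //; exact: joined_refl.
apply: (joined_trans ih).
have [mi|mi] := eqVneq m i.
  rewrite (_ : ps (m :: s) = ps s).
    by apply: joined_refl; split; [exists i|exists j]; rewrite /ps eqxx /= !andbF.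
  apply/funext => k; rewrite /ps inE mi.
  by have [->|_] := eqVneq k i; rewrite ?andbF.
have [mj|mj] := eqVneq m j.
  rewrite (_ : ps (m :: s) = ps s).
    by apply: joined_refl; split; [exists i|exists j]; rewrite /ps eqxx /= !andbF.
  apply/funext => k; rewrite /ps inE mj.
  by have [->|_] := eqVneq k j; rewrite ?andbF.
apply: (@joined_move _ _ m).
- by move=> k km; rewrite /ps inE (negPf km).
- by exists i; rewrite 1?eq_sym // /ps eqxx /= andbF.
- by exists j; rewrite 1?eq_sym // /ps eqxx /= !andbF.
Qed.

Hypothesis n3 : (2 < n)%N.

(** The path goes through the configuration with both [j] and [k] at [b]; a third point stays at
    [a], which is where [n3] enters. *)
Lemma joined_star_star j k : joined (star j) (star k).
Proof.
have [->|jk] := eqVneq j k.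
  have [l lk] : exists l, l != k.
    have : (0 < #|~: [set k]|)%N.
      by rewrite cardsC1 card_ord -ltnS prednK // (leq_trans _ n3).
    by case/card_gt0P => l; rewrite !inE => lk; exists l.
  apply: joined_refl; split; [exists l|exists k]; by rewrite /star ?eqxx ?(negPf lk).
have [l lj lk] : exists2 l, l != j & l != k.
  have : (0 < #|~: [set j; k]|)%N.
    by rewrite cardsCs finset.setCK card_ord cards2 jk subn_gt0.
  by case/card_gt0P => l; rewrite !inE negb_or => /andP[lj lk]; exists l.
pose q : conf := fun i => if (i == j) || (i == k) then b else a.
apply: (@joined_trans _ q).
  apply: (@joined_move _ _ k).
  - by move=> i ik; rewrite /star /q (negPf ik) orbF.
  - by exists l; rewrite // /star (negPf lj).
  - by exists j; rewrite // /star eqxx.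
apply: (@joined_move _ _ j).
- by move=> i ij; rewrite /star /q (negPf ij).
- by exists l; rewrite // /q (negPf lj) (negPf lk).
- by exists k; rewrite 1?eq_sym // /q eqxx orbT.
Qed.

Lemma conf_connected p q : anchored p -> anchored q -> joined p q.
Proof.
move=> [[i pi] [j pj]] [[k qk] [l ql]].
apply: joined_trans (joined_star pi pj) _.
exact: joined_trans (joined_star_star j l) (joined_sym (joined_star qk ql)).
Qed.

End Configurations.

(** * The motion planners *)

Section UpperBound.
Variables (R : realType) (n : nat) (a b : set_type (@circle R)).
Hypothesis hab : a <> b.
Local Notation C := (set_type (@circle R)).
Local Notation X := (set_type (@anchored_conf R n [set a; b])).
Local Notation conf := ('I_n -> C).
Local Notation K := (bool * 'I_n)%type.
Implicit Types (P : X * X) (J : {set K}) (k l : K).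

Definition coord P k : C :=
  (if k.1 then set_val P.1 : conf else set_val P.2 : conf) k.2.

Lemma continuous_coord2 k : continuous (fun P => coord P k).
Proof.
case: k => -[] i P.
  exact: (continuous_for_comp (f := fst) (@cvg_fst _ _ _ _ _)
    (@continuous_coord R n a b i _)).
exact: (continuous_for_comp (f := snd) (@cvg_snd _ _ _ _ _)
  (@continuous_coord R n a b i _)).
Qed.

(** [rho] measures how far [z] is from the anchors and vanishes exactly there; the sign of [side]
    tells which anchor is nearer. *)
Definition rho (z : C) : R := (1 - dot z a) * (1 - dot z b).
Definition side (z : C) : R := dot z a - dot z b.

Lemma rho_ge0 z : 0 <= rho z.
Proof. by rewrite mulr_ge0 // subr_ge0 dot_le1. Qed.

Lemma rho_eq0 z : rho z <= 0 -> z = a \/ z = b.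
Proof.
move=> r0; have /eqP : rho z = 0 by apply/eqP; rewrite eq_le r0 rho_ge0.
rewrite mulf_eq0 => /orP[] /eqP h; [left|right]; apply: dot_eq1; lra.
Qed.

Lemma rho_a : rho a = 0. Proof. by rewrite /rho dot_refl subrr mul0r. Qed.
Lemma rho_b : rho b = 0. Proof. by rewrite /rho dot_refl subrr mulr0. Qed.

Lemma side_a : 0 < side a.
Proof. by rewrite /side dot_refl subr_gt0 dot_lt1. Qed.
Lemma side_b : side b < 0.
Proof. by rewrite /side dot_refl subr_lt0 dotC dot_lt1. Qed.

Lemma cvg_rho (T : topologicalType) (f : T -> C) x :
  {for x, continuous f} -> {for x, continuous (fun t => rho (f t))}.
Proof.
move=> cf; apply: cvgM; apply: cvgB; try exact: cvg_cst.
  by apply: cvg_dot => //; exact: cvg_cst.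
by apply: cvg_dot => //; exact: cvg_cst.
Qed.

Lemma cvg_side (T : topologicalType) (f : T -> C) x :
  {for x, continuous f} -> {for x, continuous (fun t => side (f t))}.
Proof.
by move=> cf; apply: cvgB; apply: cvg_dot => //; exact: cvg_cst.
Qed.

(* [J] lists the coordinates that are farther from the anchors than all the
   others; for fixed cardinality it is determined by [P], by [far_uniq]. *)
Definition far2 J k l P :=
  [/\ k \in J -> 0 < rho (coord P k), l \notin J -> side (coord P l) != 0
    & k \in J -> l \notin J -> rho (coord P l) < rho (coord P k)].

Definition far J P := forall k l, far2 J k l P.

Lemma near_gt0 (T : topologicalType) (f : T -> R) x :
  {for x, continuous f} -> 0 < f x -> \forall y \near x, 0 < f y.
Proof. by move=> cf f0; exact: (cf _ (lt_nbhsr f0)). Qed.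

Lemma near_neq0 (T : topologicalType) (f : T -> R) x :
  {for x, continuous f} -> f x != 0 -> \forall y \near x, f y != 0.
Proof.
move=> cf; rewrite neq_lt => /orP[f0|f0].
  have cN : {for x, continuous (fun t => - f t)} by exact: cvgN.
  have : 0 < - f x by rewrite oppr_gt0.
  move=> /(near_gt0 cN); apply: filterS => y.
  by rewrite oppr_gt0 => /lt_eqF ->.
by move: f0 => /(near_gt0 cf); apply: filterS => y /gt_eqF ->.
Qed.

(** [far] is a finite conjunction of strict inequalities and inequations between continuous
    functions. *)
Lemma near_far J P : far J P -> \forall P' \near P, far J P'.
Proof.
move=> fJ; apply: (@filter_forall _ _ (fun k P' => forall l, far2 J k l P')
  (nbhs P) (nbhs_filter P)) => k.
apply: (@filter_forall _ _ (fun l P' => far2 J k l P')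
  (nbhs P) (nbhs_filter P)) => l.
have [h1 h2 h3] := fJ k l.
have crk := cvg_rho (@continuous_coord2 k P).
have crl := cvg_rho (@continuous_coord2 l P).
have csl := cvg_side (@continuous_coord2 l P).
have c3 : {for P, continuous (fun P' => rho (coord P' k) - rho (coord P' l))}.
  exact: cvgB.
have always (Q : X * X -> Prop) : (forall P', Q P') -> \forall P' \near P, Q P'.
  exact: (@filterE _ (nbhs P) (nbhs_filter P) Q).
have n1 : \forall P' \near P, k \in J -> 0 < rho (coord P' k).
  have [kJ|kJ] := boolP (k \in J); last by apply: always => P' kJ'; case/negP: kJ.
  by move: (near_gt0 crk (h1 kJ)); apply: filterS.
have n2 : \forall P' \near P, l \notin J -> side (coord P' l) != 0.
  have [lJ|lJ] := boolP (l \notin J); last by apply: always => P' lJ'; case/negP: lJ.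
  by move: (near_neq0 csl (h2 lJ)); apply: filterS.
have n3 : \forall P' \near P, k \in J -> l \notin J ->
    rho (coord P' l) < rho (coord P' k).
  have [kJ|kJ] := boolP (k \in J); last by apply: always => P' kJ'; case/negP: kJ.
  have [lJ|lJ] := boolP (l \notin J); last by apply: always => P' _ lJ'; case/negP: lJ.
  have h : 0 < rho (coord P k) - rho (coord P l) by rewrite subr_gt0 h3.
  by move: (near_gt0 c3 h); apply: filterS => P'; rewrite subr_gt0.
by move: n1 n2 n3; apply: (@filterS3 _ (nbhs P) (nbhs_filter P)) => P'.
Qed.

(** If neither set contained the other, an element of each difference would be strictly farther than
    the other. Hence each open set of the cover is a disjoint union of open pieces indexed by
    [J]. *)
Lemma far_uniq J J' P : #|J| = #|J'| -> far J P -> far J' P -> J = J'.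
Proof.
move=> cJ fJ fJ'; have [sJ|/subsetPn[k kJ kJ']] := boolP (J \subset J').
  by apply/eqP; rewrite eqEcard sJ cJ leqnn.
have [sJ'|/subsetPn[l lJ' lJ]] := boolP (J' \subset J).
  by apply/esym/eqP; rewrite eqEcard sJ' cJ leqnn.
have [_ _ /(_ kJ lJ) h1] := fJ k l; have [_ _ /(_ lJ' kJ') h2] := fJ' l k.
by have := lt_trans h1 h2; rewrite ltxx.
Qed.

Lemma far_cover P : exists2 J : {set K}, (#|J| < (2 * n - 4).+1)%N & far J P.
Proof.
(* All coordinates off the anchors are declared far. *)
exists [set k | 0 < rho (coord P k)]%SET; last first.
  move=> k l; rewrite /far2 !inE; split => // [|rk]; rewrite -leNgt => /rho_eq0.
    by case=> ->; rewrite ?(gt_eqF side_a) ?(lt_eqF side_b).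
  by case=> e; rewrite e ?rho_a ?rho_b.
set J := [set _ | _]%SET.
have [[i1 e1] [i2 e2]] := anchored_val P.1.
have [[i3 e3] [i4 e4]] := anchored_val P.2.
have i12 : i1 != i2 by apply/eqP => e; apply: hab; apply: (etrans (esym e1)); rewrite e.
have i34 : i3 != i4 by apply/eqP => e; apply: hab; apply: (etrans (esym e3)); rewrite e.
(* Each configuration has one point at [a] and another at [b]: four coordinates that are not far. *)
pose s : seq K := [:: (true, i1); (true, i2); (false, i3); (false, i4)].
have us : uniq s by rewrite /= !inE !xpair_eqE /= (negPf i12) (negPf i34).
have sJ : {subset s <= ~: J}.
  move=> k; rewrite !inE -leNgt => /or4P[] /eqP ->; rewrite /coord /=.
  - by rewrite e1 rho_a.
  - by rewrite e2 rho_b.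
  - by rewrite e3 rho_a.
  - by rewrite e4 rho_b.
have := uniq_leq_size us (s2 := enum (~: J)).
rewrite -cardE => /(_ _) h; have : (4 <= #|~: J|)%N.
  by apply: h => k /sJ; rewrite mem_enum.
have := cardsC J; rewrite card_prod card_bool card_ord => <- h4.
by rewrite ltnS leq_subRL ?(leq_trans h4 (leq_addl _ _)) // addnC leq_add2l.
Qed.

Definition target J P k : C :=
  if k \in J then rot b pi else if 0 < side (coord P k) then a else b.

(** Outside [J] the function [side] has no zero, so its sign is locally constant. *)
Lemma near_target J P : far J P -> \forall P' \near P, target J P' = target J P.
Proof.
move=> fJ; suff H : \forall P' \near P, forall k, target J P' k = target J P k.
  by move: H; apply: filterS => P' h; apply/funext.
apply: (@filter_forall _ _ (fun k P' => target J P' k = target J P k)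
  (nbhs P) (nbhs_filter P)) => k.
rewrite /target.
have [kJ|kJ] := boolP (k \in J); first by apply: (@filterE _ (nbhs P) (nbhs_filter P)).
have [_ /(_ kJ) s0 _] := fJ k k.
have cs := cvg_side (@continuous_coord2 k P).
move: s0; rewrite neq_lt => /orP[s0|s0]; last first.
  by rewrite s0; move: (near_gt0 cs s0); apply: filterS => P' ->.
have cN : {for P, continuous (fun P' => - side (coord P' k))} by exact: cvgN.
have h : 0 < - side (coord P k) by rewrite oppr_gt0.
move: (near_gt0 cN h); apply: filterS => P'; rewrite oppr_gt0 => s'.
by rewrite (lt_gtF s0) (lt_gtF s').
Qed.

(** A far point differs from [b], so it is not opposite to the antipode of [b]; a point opposite to
    one anchor is not strictly nearer to it than to the other. *)
Lemma dot_target J P k : far J P -> 1 + dot (coord P k) (target J P k) != 0.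
Proof.
move=> fJ; have [h1 h2 _] := fJ k k; rewrite /target.
have [kJ|kJ] := boolP (k \in J).
  have -> : dot (coord P k) (rot b pi) = - dot (coord P k) b.
    by rewrite /dot cx_rot cy_rot cospi sinpi; ring.
  by have := h1 kJ; case: eqP => // e; rewrite /rho e mulr0 ltxx.
have := h2 kJ; have := dot_geN1 (coord P k) a; have := dot_geN1 (coord P k) b.
rewrite /side; case: ltP => s b1 a1 s0; rewrite gt_eqF //; first lra.
have : dot (coord P k) a - dot (coord P k) b < 0 by rewrite lt_neqAle s0.
lra.
Qed.

Lemma target_anchor J P k : far J P -> coord P k = a \/ coord P k = b ->
  target J P k = coord P k.
Proof.
move=> fJ h; have [h1 _ _] := fJ k k; rewrite /target.
have kJ : k \notin J.
  by apply/negP => /h1; case: h => ->; rewrite ?rho_a ?rho_b ltxx.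
rewrite (negPf kJ); case: h => ->; first by rewrite side_a.
by rewrite (lt_gtF side_b).
Qed.

Lemma target_anchored J P s : far J P -> anchored a b (fun i => target J P (s, i)).
Proof.
move=> fJ.
have : anchored a b (fun i => coord P (s, i)).
  by case: s; rewrite /coord /=; exact: anchored_val.
move=> [[i ei] [j ej]]; split; [exists i|exists j].
  by rewrite target_anchor ?ei //; left.
by rewrite target_anchor ?ej //; right.
Qed.

(* The three thirds of the time interval are used to reach [c], to follow [psi]
   to [c'], and to leave [c']; clipping the times makes the angles add up, so the
   pieces need not be glued. *)
Definition planner (psi : 'I_n -> R -> R) (c c' : conf) P (t : R) : conf :=
  fun i => rot (coord P (true, i))
    (clip (3 * t + 0) * ang (coord P (true, i)) (c i) + psi i (clip (3 * t + - 1)) +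
     clip (3 * t + - 2) * ang (c' i) (coord P (false, i))).

(** At first the anchored points of the first configuration do not move, then [psi] stays anchored,
    and at last the points bound for the anchors are already there. *)
Lemma planner_anchored J psi P t : far J P ->
  let c := (fun i => target J P (true, i)) in
  let c' := (fun i => target J P (false, i)) in
  conf_path a b c c' psi -> anchored a b (planner psi c c' P t).
Proof.
move=> fJ c c' [cpsi psi0 psi1 psia].
have d1 i : rot (coord P (true, i)) (ang (coord P (true, i)) (c i)) = c i.
  by rewrite rot_ang // dot_target.
have [t1|t1] := lerP t (1 / 3).
  have E i : coord P (true, i) = a \/ coord P (true, i) = b ->
      planner psi c c' P t i = coord P (true, i).
    move=> h; rewrite /planner (@clip_eq0 _ (3 * t + - 1)); last lra.
    rewrite (@clip_eq0 _ (3 * t + - 2)); last lra.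
    by rewrite psi0 mul0r !addr0 /c target_anchor // ang_refl mulr0 rot0.
  have [[i ei] [j ej]] := anchored_val P.1.
  by split; [exists i; rewrite E //; left|exists j; rewrite E //; right].
have [t2|t2] := lerP t (2 / 3).
  rewrite (_ : planner _ _ _ _ _ = (fun i => rot (c i) (psi i (clip (3 * t + - 1))))).
    exact/psia/clip01.
  apply/funext => i; rewrite /planner (@clip_eq1 _ (3 * t + 0)); last lra.
  rewrite (@clip_eq0 _ (3 * t + - 2)); last lra.
  by rewrite mul0r addr0 mul1r rotD d1.
have E i : coord P (false, i) = a \/ coord P (false, i) = b ->
    planner psi c c' P t i = coord P (false, i).
  move=> h; rewrite /planner (@clip_eq1 _ (3 * t + 0)); last lra.
  rewrite (@clip_eq1 _ (3 * t + - 1)); last lra.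
  by rewrite mul1r !rotD d1 psi1 /c' target_anchor // ang_refl mulr0 rot0.
have [[i ei] [j ej]] := anchored_val P.2.
by split; [exists i; rewrite E //; left|exists j; rewrite E //; right].
Qed.

Lemma planner0 psi c c' P : conf_path a b c c' psi ->
  planner psi c c' P 0 = set_val P.1.
Proof.
move=> [_ psi0 _ _]; apply/funext => i.
by rewrite /planner !(@clip_eq0 R) ?psi0 ?mul0r ?addr0 ?rot0 //; lra.
Qed.

Lemma planner1 J psi P : far J P ->
  let c := (fun i => target J P (true, i)) in
  let c' := (fun i => target J P (false, i)) in
  conf_path a b c c' psi -> planner psi c c' P 1 = set_val P.2.
Proof.
move=> fJ c c' [_ _ psi1 _]; apply/funext => i.
have e d : -2 <= d -> clip (3 * 1 + d) = 1 :> R by move=> d2; apply: clip_eq1; lra.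
rewrite /planner !e ?mul1r; [|lra..].
rewrite !rotD rot_ang ?dot_target // psi1 rot_ang // dotC.
exact: dot_target.
Qed.

Lemma cvg_planner (T : topologicalType) (psi : 'I_n -> R -> R) c c'
    (f : T -> X * X) (g : T -> R) x i :
  (forall i, continuous (psi i)) ->
  1 + dot (coord (f x) (true, i)) (c i) != 0 ->
  1 + dot (coord (f x) (false, i)) (c' i) != 0 ->
  {for x, continuous f} -> {for x, continuous g} ->
  {for x, continuous (fun t => planner psi c c' (f t) (g t) i)}.
Proof.
move=> cpsi d1 d2 cf cg.
have ck k : {for x, continuous (fun t => coord (f t) k)}.
  exact: (continuous_for_comp cf (@continuous_coord2 k _)).
have ccl d : {for x, continuous (fun t => clip (3 * g t + d))}.
  exact: (continuous_for_comp cg (@continuous_clip_affine R 3 d _)).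
have cstC (z : C) : {for x, continuous (fun _ : T => z)} by exact: cvg_cst.
apply: cvg_rot; first exact: ck.
apply: cvgD; first apply: cvgD.
- by apply: cvgM; [exact: ccl|exact: (cvg_ang (ck _) (cstC _))].
- exact: (continuous_for_comp (ccl _) (cpsi i _)).
apply: cvgM; first exact: ccl.
by apply: (cvg_ang (cstC _) (ck _)); rewrite dotC.
Qed.

Hypothesis n3 : (2 < n)%N.

Lemma upper_bound : has_motion_planner R X (2 * n - 4).
Proof.
pose U (i : 'I_(2 * n - 4).+1) : set (X * X) :=
  [set P | exists2 J : {set K}, #|J| = i & far J P].
exists U; split.
- move=> i; rewrite openE => P [J cJ fJ]; rewrite /interior.
  by move: (near_far fJ); apply: filterS => P' fJ'; exists J.
- apply/seteqP; split => // P _; have [J cJ fJ] := far_cover P.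
  by exists (Ordinal cJ) => //; exists J.
move=> i.
(* One path is fixed per pair of configurations, so it depends on the point only through its locally
   constant targets. Pairs that are not anchored get a default. *)
have /choice[Psi HPsi] (pq : conf * conf) : exists psi : 'I_n -> R -> R,
    anchored a b pq.1 -> anchored a b pq.2 -> conf_path a b pq.1 pq.2 psi.
  case: pq => p q /=.
  have [ap|ap] := pselect (anchored a b p); last by exists (fun _ _ => 0) => /ap.
  have [aq|aq] := pselect (anchored a b q); last by exists (fun _ _ => 0) => _ /aq.
  by have [psi h] := conf_connected hab n3 ap aq; exists psi.
have /choice[Jof HJ] (z : set_type (U i)) : exists J : {set K},
    #|J| = i /\ far J (set_val z).
  by have [J cJ fJ] := set_valP z; exists J.
pose c z s : conf := fun j => target (Jof z) (set_val z) (s, j).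
have ac z s : anchored a b (c z s) by apply: target_anchored; case: (HJ z).
have cpath z : conf_path a b (c z true) (c z false) (Psi (c z true, c z false)).
  exact: (HPsi (c z true, c z false) (ac z true) (ac z false)).
pose pl z t := planner (Psi (c z true, c z false)) (c z true) (c z false) (set_val z) t.
have apl z t : anchored a b (pl z t).
  by have [_ fJ] := HJ z; exact: (planner_anchored t fJ (cpath z)).
pose H (zt : set_type (U i) * unit_interval R) : X := mkX (apl zt.1 (set_val zt.2)).
have cH : continuous H.
  move=> [z t]; apply: cvg_conf => j; have [cJ fJ] := HJ z.
  (* [G] freezes the targets and the connecting path at their values for [z]; it is continuous at
     [(z, t)] and agrees with [H] nearby. *)
  pose G (zt : set_type (U i) * unit_interval R) :=
    planner (Psi (c z true, c z false)) (c z true) (c z false) (set_val zt.1)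
      (set_val zt.2) j.
  have cv : {for (z, t), continuous (fun zt : set_type (U i) * unit_interval R =>
      set_val zt.1)}.
    exact: (continuous_for_comp (f := fst) (@cvg_fst _ _ _ _ _)
      (@continuous_set_val _ _ _)).
  have ct : {for (z, t), continuous (fun zt : set_type (U i) * unit_interval R =>
      set_val zt.2)}.
    exact: (continuous_for_comp (f := snd) (@cvg_snd _ _ _ _ _)
      (@continuous_set_val _ _ _)).
  have cG : {for (z, t), continuous G}.
    case: (cpath z) => cpsi _ _ _.
    by apply: cvg_planner => //; exact: dot_target.
  have HG : \forall zt \near (z, t), G zt = set_val (H zt) j.
    have : \forall P \near set_val z, far (Jof z) P /\
        target (Jof z) P = target (Jof z) (set_val z).
      by apply: filterI; [exact: near_far|exact: near_target].
    move=> /cv; apply: (@filterS _ (nbhs (z, t)) (nbhs_filter (z, t))) => -[z' t'] /= [fJ' eT].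
    have eJ : Jof z' = Jof z.
      by case: (HJ z') => cJ' f'; apply: (far_uniq _ f' fJ'); rewrite cJ' cJ.
    have ec s : c z' s = c z s by rewrite /c eJ eT.
    by rewrite /G /H mkXE /pl /= !ec.
  have e : G (z, t) = set_val (H (z, t)) j := nbhs_singleton HG.
  have cG' : G zt @[zt --> (z, t)] --> set_val (H (z, t)) j by rewrite -e.
  exact: (cvg_trans (near_eq_cvg HG) cG').
have [s [cs sE]] := path_of_homotopy cH.
exists s; split => // z; rewrite /path_ends !sE.
have [cJ fJ] := HJ z.
have e0 : H (z, time0 R) = (set_val z).1.
  by apply: val_inj; exact: (planner0 _ (cpath z)).
have e1 : H (z, time1 R) = (set_val z).2.
  by apply: val_inj; exact: (planner1 fJ (cpath z)).
by rewrite e0 e1; case: (set_val z).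
Qed.

End UpperBound.

(** * The torus in the product of two configuration spaces *)

Section WindingOfSection.
Variables (R : realType) (X : topologicalType) (U : set (X * X)).
Local Notation C := (set_type (@circle R)).
Variables (s : set_type U -> path_space R X) (pr : X -> C).
Hypothesis cs : continuous s.
Hypothesis sE : forall z, path_ends (s z) = set_val z.
Hypothesis cpr : continuous pr.

Definition spath (z : set_type U) (t : R) : C := pr (path_fun (s z) (clamp t)).

Lemma spath0 z : spath z 0 = pr (set_val z).1.
Proof. by rewrite /spath clamp0 -sE. Qed.

Lemma spath1 z : spath z 1 = pr (set_val z).2.
Proof. by rewrite /spath clamp1 -sE. Qed.

Lemma continuous_spath_pair :
  continuous (fun p : set_type U * unit_interval R => pr (path_fun (s p.1) p.2)).
Proof.
move=> p; apply: (@continuous_for_comp _ X C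
  (fun p : set_type U * unit_interval R => path_fun (s p.1) p.2) pr).
  exact: continuous_path_eval.
exact: cpr.
Qed.

Lemma continuous_spath z : continuous (spath z).
Proof.
move=> t; apply: (continuous_for_comp (f := fun t => (z, clamp t))
  (g := fun p : set_type U * unit_interval R => pr (path_fun (s p.1) p.2))).
  by apply: continuous_for_pair; [exact: cvg_cst|exact: continuous_clamp].
exact: continuous_spath_pair.
Qed.

(** Compactness of the interval makes one neighbourhood of [z0] work for all times. *)
Lemma near_spath z0 : \forall z \near z0, forall t,
  0 < dot (spath z0 t) (spath z t).
Proof.
pose g (p : set_type U * unit_interval R) := pr (path_fun (s p.1) p.2).
pose P z (t : unit_interval R) := 0 < dot (g (z0, t)) (g (z, t)).
have /compact_near_coveringP cpt := @unit_interval_compact R.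
have H : \forall z \near z0, [set: unit_interval R] `<=` P z.
  apply: (cpt _ (nbhs z0) P) => t _.
  have cd : {for (t, z0), continuous
      (fun p : unit_interval R * set_type U => dot (g (z0, p.1)) (g (p.2, p.1)))}.
    apply: cvg_dot.
      apply: (continuous_for_comp
        (f := fun p : unit_interval R * set_type U => (z0, p.1)) (g := g)).
        by apply: continuous_for_pair; [exact: cvg_cst|exact: cvg_fst].
      exact: continuous_spath_pair.
    apply: (continuous_for_comp
        (f := fun p : unit_interval R * set_type U => (p.2, p.1)) (g := g)).
      by apply: continuous_for_pair; [exact: cvg_snd|exact: cvg_fst].
    exact: continuous_spath_pair.
  have d0 : 0 < dot (g (z0, (t, z0).1)) (g ((t, z0).2, (t, z0).1)).
    by rewrite dot_refl.
  exact: (cd _ (lt_nbhsr d0)).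
by move: H; apply: filterS => z h t; exact: (h (clamp t) I).
Qed.

(** [W z] is the angle swept along the planned path. Nearby paths are uniformly close, so [W]
    changes only by the angles at the two ends. *)
Lemma section_winding : exists W : set_type U -> R,
  (forall z, rot (pr (set_val z).1) (W z) = pr (set_val z).2) /\
  (forall z0, \forall z \near z0,
     W z = W z0 + ang (pr (set_val z0).2) (pr (set_val z).2)
                - ang (pr (set_val z0).1) (pr (set_val z).1)).
Proof.
have /choice[W HW] (z : set_type U) : exists w, winds (spath z) w.
  exact/winds_exists/continuous_spath.
exists W; split=> [z|z0].
  have [l [_ _ l1 lr]] := HW z.
  by rewrite -spath0 -spath1 (lr 1) ?lexx ?ler01 // l1.
move: (near_spath z0); apply: filterS => z dz; apply: winds_uniq (HW z) _.
rewrite -!spath0 -!spath1; apply: winds_perturb => //.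
- exact: continuous_spath.
- exact: continuous_spath.
by move=> t _; rewrite gt_eqF // addr_gt0.
Qed.

End WindingOfSection.

Lemma cvg_scaled_turn (R : realType) (T : topologicalType) (f : T -> R)
    (z : set_type (@circle R)) (c : R) x :
  {for x, continuous f} -> {for x, continuous (fun t => rot z (f t * c))}.
Proof.
move=> cf; apply: (@cvg_rot R T (fun=> z)); first exact: cvg_cst.
by apply: cvgM => //; exact: cvg_cst.
Qed.

Lemma sub_turns (F : fieldType) (x v p k : F) :
  p != 0 -> x * p - v = k * p -> x - v / p = k.
Proof. by move=> p0 h; rewrite -[RHS](mulfK p0) -h mulrBl mulfK. Qed.

Lemma turns_add1 (F : fieldType) (x y v p : F) : p != 0 ->
  y - 1 * (v + (y - x) * p) / p = x - 1 * v / p.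
Proof. by move=> p0; field. Qed.

Lemma turns_addN1 (F : fieldType) (x y v p : F) : p != 0 ->
  y - -1 * (v - (y - x) * p) / p = x - -1 * v / p.
Proof. by move=> p0; field. Qed.

(** * Coordinate functions on the torus family *)

Section TorusFamily.
Variables (R : realType) (n : nat) (a b : set_type (@circle R)).
Hypothesis n4 : (3 < n)%N.
Local Notation C := (set_type (@circle R)).
Local Notation X := (set_type (@anchored_conf R n [set a; b])).
Local Notation conf := ('I_n -> C).
Implicit Types (x y : 'rV[R]_n) (m : 'I_n).

(** By parity, the indices 0 and 1 hold [a] and [b], and so do 2 and 3. *)
Definition base m : C := if odd m then b else a.
Definition turned x m : C := rot (base m) (x ord0 m * (2 * pi)).

(* A copy of the [n]-torus in [X * X] on which the ratios of the coordinates
   of the two configurations are, up to sign, the coordinates of the torus. *)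
Definition torus_fst x : conf := fun m => if (m < 2)%N then base m else turned x m.
Definition torus_snd x : conf := fun m => if (m < 2)%N then turned x m else base m.

Lemma torus_fst_anchored x : anchored a b (torus_fst x).
Proof.
have n0 : (0 < n)%N by apply: leq_trans n4.
have n1 : (1 < n)%N by apply: leq_trans n4.
by split; [exists (Ordinal n0)|exists (Ordinal n1)].
Qed.

Lemma torus_snd_anchored x : anchored a b (torus_snd x).
Proof.
have n2 : (2 < n)%N by apply: leq_trans n4.
by split; [exists (Ordinal n2)|exists (Ordinal n4)].
Qed.

Definition torus x : X * X :=
  (mkX (torus_fst_anchored x), mkX (torus_snd_anchored x)).

Lemma continuous_turned m : continuous (fun x => turned x m).
Proof.
move=> x; apply: cvg_scaled_turn; exact: coord_continuous.
Qed.

Lemma continuous_torus : continuous torus.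
Proof.
move=> x; apply: continuous_for_pair; apply: cvg_conf => m.
  rewrite (_ : (fun t => _) = fun t => torus_fst t m) // /torus_fst.
  by case: (m < 2)%N; [exact: (@cst_continuous _ C)|exact: continuous_turned].
rewrite (_ : (fun t => _) = fun t => torus_snd t m) // /torus_snd.
by case: (m < 2)%N; [exact: continuous_turned|exact: (@cst_continuous _ C)].
Qed.

Lemma torus_periodic x y : (forall m, exists k : int, x ord0 m = y ord0 m + k%:~R) ->
  torus x = torus y.
Proof.
move=> h; have e m : turned x m = turned y m.
  by have [k ek] := h m; rewrite /turned ek mulrDl rotD rot_int.
congr (_, _); apply: val_inj; apply/funext => m /=.
  by rewrite /torus_fst e.
by rewrite /torus_snd e.
Qed.

(** [K] is the [m]-th coordinate minus the signed winding of the planned path in turns. The winding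
    depends only on the point of the torus, so over [U] the function [K] trivializes the [m]-th
    coordinate class. *)
Lemma torus_coordinate (U : set (X * X)) (s : set_type U -> path_space R X) m :
  open U -> continuous s -> (forall z, path_ends (s z) = set_val z) ->
  exists K : 'rV[R]_n -> R,
  [/\ forall x, U (torus x) -> exists k : int, K x = k%:~R,
      forall x, U (torus x) -> \forall y \near x, K y = K x
    & forall x y, U (torus x) -> torus y = torus x ->
        K y - K x = y ord0 m - x ord0 m].
Proof.
move=> oU cs sE.
have [W [W1 W2]] := section_winding cs sE (@continuous_coord R n a b m).
have p0 : (2 * pi : R) != 0 by rewrite mulf_neq0 ?pnatr_eq0 // gt_eqF // pi_gt0.
(* For [m] at least 2 the turned point belongs to the first configuration, so the planner turns it
   back. *)
pose eps : R := if (m < 2)%N then 1 else -1.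
pose inU P (h : U P) : set_type U := exist (fun P => P \in U) P (mem_set h).
pose w x : R := if pselect (U (torus x)) is left h then W (inU _ h) else 0.
have wE x (h : U (torus x)) : w x = W (inU _ h).
  by rewrite /w; case: pselect => // h'; congr (W (inU _ _)); exact: Prop_irrelevance.
exists (fun x => x ord0 m - eps * w x / (2 * pi)); split.
- move=> x Ux; rewrite wE; have := W1 (inU _ Ux).
  rewrite set_valE /= /torus_fst /torus_snd /eps; case: (m < 2)%N.
    move=> /rot_inj[k]; set v := W _ => hk; exists k.
    by rewrite mul1r; exact: sub_turns p0 hk.
  rewrite /turned -rotD -[X in _ = X -> _]rot0 => /rot_inj[k]; set v := W _ => hk.
  exists (- k); apply: (sub_turns p0); rewrite mulrNz [RHS]mulNr -hk; ring.
- move=> x Ux; have [_ /= [[V oV <-] /= Vx] subV] := W2 (inU _ Ux).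
  have nU : \forall y \near x, U (torus y).
    exact: (continuous_torus (open_nbhs_nbhs (conj oU Ux))).
  have nV : \forall y \near x, V (torus y).
    exact: (continuous_torus (open_nbhs_nbhs (conj oV Vx))).
  have cf : {for x, continuous (fun y : 'rV[R]_n => y ord0 m)}.
    exact: coord_continuous.
  (* Within half a turn, [ang] recovers the true difference of angles. *)
  have nh : \forall y \near x, `|x ord0 m - (y : 'rV[R]_n) ord0 m| < 1 / 2.
    have h2 : (0 : R) < 1 / 2 by rewrite divr_gt0.
    have nb : nbhs (x ord0 m) (ball (x ord0 m) (1 / 2)) by exact: nbhsx_ballx.
    exact: (cf _ nb).
  move: nU nV nh; apply: filterS3 => y Uy Vy dxy.
  rewrite !wE (subV (inU _ Uy) Vy) !set_valE /= /torus_fst /torus_snd /eps.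
  have aturn : ang (turned x m) (turned y m) = (y ord0 m - x ord0 m) * (2 * pi).
    have -> : turned y m = rot (turned x m) ((y ord0 m - x ord0 m) * (2 * pi)).
      by rewrite /turned -rotD; congr rot; ring.
    apply: ang_rot; rewrite normrM (gtr0_norm (x := 2 * pi)); last first.
      by rewrite mulr_gt0 // pi_gt0.
    rewrite distrC mulrA -ltr_pdivlMr ?pi_gt0 // divff ?gt_eqF ?pi_gt0 //.
    by rewrite -ltr_pdivlMr.
  case: (m < 2)%N; rewrite ang_refl aturn; set v := W _.
    by rewrite subr0 turns_add1.
  by rewrite addr0 turns_addN1.
move=> x y Ux e; have Uy : U (torus y) by rewrite e.
rewrite !wE (_ : inU _ Ux = inU _ Uy); last by apply: val_inj => /=.
by ring.
Qed.

End TorusFamily.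

(** * The lower bound, from a fine grid on the torus *)

Section LowerBound.
Variables (R : realType) (n : nat) (a b : set_type (@circle R)).
Hypothesis n4 : (3 < n)%N.
Local Notation C := (set_type (@circle R)).
Local Notation X := (set_type (@anchored_conf R n [set a; b])).
Local Notation Phi := (torus a b n4).
Implicit Types (x y : 'rV[R]_n).

Lemma locally_const_segment (D : set 'rV[R]_n) (K : 'rV[R]_n -> R) x y :
  (forall z, D z -> exists k : int, K z = k%:~R) ->
  (forall z, D z -> \forall z' \near z, K z' = K z) ->
  (forall t, 0 <= t <= 1 -> D (x + t *: (y - x))) -> K x = K y.
Proof.
move=> K1 K2 Dxy; pose f t := K (x + t *: (y - x)).
have -> : K x = f 0 by rewrite /f scale0r addr0.
have -> : K y = f 1 by rewrite /f scale1r addrC subrK.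
apply: integer_valued_const => [|t t01]; last exact/K1/Dxy.
apply: continuous_at_within => t /=; rewrite in_itv /= => t01.
have line : {for t, continuous (fun t : R => x + t *: (y - x))}.
  apply: cvgD; first exact: cvg_cst.
  by apply: cvgZr_tmp; exact: cvg_id.
have nf : \forall t' \near t, cst (f t) t' = f t'.
  move: (line _ (K2 _ (Dxy t t01))).
  by apply: (@filterS _ (nbhs t) (nbhs_filter t)) => t' e; exact: esym e.
exact: (cvg_trans (near_eq_cvg nf) (cvg_cst _)).
Qed.

(** A Lebesgue number, in the maximum norm, of the cover pulled back to the unit cube. *)
Lemma lebesgue_cube (I : Type) (U : I -> set (X * X)) :
  (forall i, open (U i)) -> \bigcup_i U i = setT ->
  exists M : nat, forall x, (forall j, 0 <= x ord0 j <= 1) ->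
    exists i, forall y, (forall j, `|x ord0 j - y ord0 j| <= M.+1%:R^-1) ->
      U i (Phi y).
Proof.
move=> oU cU.
pose P (M : nat) x := exists i, forall y,
  (forall j, `|x ord0 j - y ord0 j| <= M.+1%:R^-1) -> U i (Phi y).
have /compact_near_coveringP cpt : compact
    [set v : 'rV[R]_n | forall i, `[0, 1]%classic (v ord0 i)].
  exact: (@rV_compact R n (fun=> `[0, 1]%classic) (fun=> @segment_compact R 0 1)).
have [|M _ HM] := cpt nat \oo P _; last first.
  exists M => x x01; apply: (HM M) => /=; first exact: leqnn.
  by move=> j; have := x01 j; rewrite /mkset /= in_itv.
move=> x _; have [i _ Ui] : (\bigcup_i U i) (Phi x) by rewrite cU.
have : nbhs x (Phi @^-1` U i).
  exact: (continuous_torus (open_nbhs_nbhs (conj (oU i) Ui))).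
move=> /nbhs_ballP[e /= e0 He].
have e2 : 0 < e / 2 by rewrite divr_gt0.
exists (ball x (e / 2), [set N : nat | N.+1%:R^-1 < e / 2]).
  split; first exact: nbhsx_ballx.
  exact: near_infty_natSinv_lt (PosNum e2).
move=> [x' N] /= [[_ xx'] Ne]; exists i => y x'y; apply: He; split => // i0 j.
rewrite ord1 /ball /= (_ : _ - _ = (x ord0 j - x' ord0 j) + (x' ord0 j - y ord0 j)); last by ring.
rewrite (le_lt_trans (ler_normD _ _)) // (splitr e) ltrD //.
  by have := xx' ord0 j.
exact: le_lt_trans (x'y j) Ne.
Qed.

Lemma convex01 (c d : bool) (t : R) : 0 <= t <= 1 ->
  0 <= c%:R + t * (d%:R - c%:R) <= 1.
Proof. by case: c d => -[] /andP[t0 t1]; rewrite /= !(mulr0n, mulr1n); apply/andP; split; lra. Qed.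

(** The carry when a bit is added modulo [N.+2]. *)
Lemma Zp_addb (N : nat) (u : 'Z_N.+2) (c : bool) :
  (nat_of_ord (u + c%:R)%R + (c && (u == (-1)%R)) * N.+2 = u + c)%N.
Proof.
have vN1 : nat_of_ord (-1 : 'Z_N.+2) = N.+1.
  by rewrite /= (modn_small (m := 1)) // subn1 /= modn_small.
case: c; last by rewrite addr0 mul0n.
rewrite (_ : true%:R = 1) //.
have [->|uN] := eqVneq u (-1); first by rewrite addrC subrr vN1 mul1n addn1.
rewrite andbF /= mul0n addn0 (modn_small (m := 1)) // modn_small // addn1 ltnS.
have := ltn_ord u; rewrite ltnS leq_eqVlt => /orP[/eqP e|//].
by case/eqP: uN; apply: val_inj; rewrite [RHS]vN1.
Qed.

Lemma lower_bound (k : nat) : has_motion_planner R X k -> (n <= k)%N.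
Proof.
move=> [U [oU cU sU]]; rewrite leqNgt; apply/negP => kn.
have [M HM] := lebesgue_cube oU cU.
(* There are at most [n] sets in the cover, so the [i]-th can be assigned the [i]-th coordinate. *)
have /choice[K HK] (i : 'I_k.+1) : exists K : 'rV[R]_n -> R,
  [/\ forall x, U i (Phi x) -> exists k : int, K x = k%:~R,
      forall x, U i (Phi x) -> \forall y \near x, K y = K x
    & forall x y, U i (Phi x) -> Phi y = Phi x ->
        K y - K x = y ord0 (widen_ord kn i) - x ord0 (widen_ord kn i)].
  by have [s [cs sE]] := sU i; exact: (torus_coordinate n4 _ (oU i) cs sE).
(* With [M.+2] steps the mesh is below the Lebesgue number and the modulus is at least 2, as ['Z_]
   requires. *)
pose pt (v : {ffun 'I_n -> 'Z_M.+2}) : 'rV[R]_n :=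
  \row_j ((v j : nat)%:R / M.+2%:R).
(* [K] reduced modulo 2; where it is not an integer or [m] exceeds [k], [floor] and [inord] supply
   defaults. *)
pose f (m : 'I_n) v : 'F_2 := (Num.floor (K (inord m) (pt v)))%:~R.
apply: (@torus_cup_nonzero n M.+2 f) => v.
have N0 : 0 < M.+2%:R :> R by rewrite ltr0n.
have NN : (M.+2%:R : R) != 0 by rewrite gt_eqF.
(* The vertices of the cube at [v], lifted to the plain vector space without reduction modulo 1;
   [wrap] records the coordinates in which the reduction subtracts 1. *)
pose Y (A : {set 'I_n}) : 'rV[R]_n := pt v + \row_l ((l \in A)%:R / M.+2%:R).
have [|i Hi] := HM (pt v).
  by move=> j; rewrite mxE divr_ge0 //= ler_pdivrMr // mul1r ler_nat ltnW.
have [K1 K2 K3] := HK i; set m := widen_ord kn i in K3.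
pose wrap (A : {set 'I_n}) (l : 'I_n) : bool := (l \in A) && (v l == -1).
have im : inord m = i :> 'I_k.+1 by apply: val_inj; rewrite /= inordK.
have ptY A l : pt (v + vec M.+2 A) ord0 l = Y A ord0 l - (wrap A l)%:R.
  rewrite !mxE !ffunE -mulrDl -natrD -Zp_addb natrD natrM mulrDl mulfK //.
  by rewrite addrK.
have seg A j t : 0 <= t <= 1 -> U i (Phi (Y A + t *: (Y (j |: A) - Y A))).
  move=> t01; apply: Hi => l; rewrite !mxE.
  set p := _ / _; set al := (l \in A)%:R; set be := (l \in j |: A)%:R.
  rewrite (_ : p - _ = - ((al + t * (be - al)) / M.+2%:R)); last by ring.
  have /andP[c0 c1] : 0 <= al + t * (be - al) <= 1 by exact: convex01.
  rewrite normrN ger0_norm; last by rewrite divr_ge0.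
  apply: (@le_trans _ _ M.+2%:R^-1).
    by rewrite ler_pdivrMr // mulVf.
  by rewrite lef_pV2 ?posrE ?ltr0n // ler_nat.
have UY A : U i (Phi (Y A)).
  by have := seg A m 0; rewrite scale0r addr0 lexx ler01; apply.
(* The edges of the lifted cube stay inside [U i], where [K i] is locally constant. *)
have YY A j : K i (Y A) = K i (Y (j |: A)).
  by apply: (locally_const_segment K1 K2); exact: seg.
have fE A q : K i (Y A) = q%:~R ->
    f m (v + vec M.+2 A) = q%:~R - (wrap A m)%:R.
  move=> Kq; have eT : Phi (pt (v + vec M.+2 A)) = Phi (Y A).
    apply: torus_periodic => l; exists (- (wrap A l)%:Z).
    by rewrite ptY mulrNz -pmulrn.
  have := K3 _ _ (UY A) eT; rewrite ptY Kq [X in _ = X]addrAC subrr add0r.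
  move=> /eqP; rewrite subr_eq => /eqP e.
  have {}e : K i (pt (v + vec M.+2 A)) = (q - (wrap A m)%:Z)%:~R.
    by rewrite e intrD mulrNz -pmulrn addrC.
  by rewrite /f im e intrKfloor intrD mulrNz -pmulrn.
(* Along an edge [f m] changes only through [wrap], that is, exactly where the winding cochain is 1,
   so the two cancel. *)
exists m => A j jA.
have [q Hq] := K1 _ (UY A).
have Hq' : K i (Y (j |: A)) = q%:~R by rewrite -YY.
rewrite /coboundary vecU1 // (fE _ _ Hq) (fE _ _ Hq') /winding_cochain.
have -> : (v + vec M.+2 A) j = v j by rewrite !ffunE (negPf jA) addr0.
rewrite /wrap in_setU1; have [e|jm] := eqVneq j m.
  rewrite -e (negPf jA) /=.
  by rewrite subr0 addrA [_ + (_ - _)]addrC subrK addFF.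
by rewrite /= add0r addFF.
Qed.

End LowerBound.

Local Open Scope ereal_scope.

Theorem theorem5p3 (R : realType) (a b : set_type (@circle R)) (hab : a <> b)
    (n : nat) (hn : (4 <= n)%N) :
  n%:R%:E <= TC R (set_type (@anchored_conf R n [set a; b]))
  /\ TC R (set_type (@anchored_conf R n [set a; b])) <= (2 * n - 4)%N%:R%:E.
Proof.
split.
  apply: le_ereal_inf_tmp => _ [k hk <-]; rewrite lee_fin ler_nat.
  exact: (lower_bound hn hk).
apply: ereal_inf_lbound; exists (2 * n - 4)%N => //.
by apply: upper_bound; last exact: leq_trans hn.
Qed.
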